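(* Let $f:\mathbb{R}^n\to\mathbb{R}$ be $C^2$ and bounded below, with $\|\nabla f(x)-\nabla f(y)\|\le L\|x-y\|$ and $\|\nabla^2 f(x)-\nabla^2 f(y)\|\le M\|x-y\|$ for all $x,y\in\mathbb{R}^n$. Let $$0<\varepsilon\le \frac{M^2}{8},\qquad \delta=\Big(\sqrt{n/s}+\mathcal{C}\Big)^2\sqrt{\varepsilon},\qquad \Delta=\frac{\sqrt{\varepsilon}}{M}.$$ If there is a constant $\tau>0$ such that $s=O(n\,\varepsilon^{1/\tau})$, then the algorithm RSHTR, run from $x_0$ with subspace dimension $s$ and parameters $\delta,\Delta$, outputs an $\varepsilon$-FOSP in at most $O(\varepsilon^{-3/2})$ iterations, with probability at least $$1-4\exp(-Cs/4)-(2U_\varepsilon+2)\exp(-s),\qquad U_\varepsilon:=\Big\lfloor 3M^2\big(f(x_0)-\inf_{x\in\mathbb{R}^n}f(x)\big)\varepsilon^{-3/2}\Big\rfloor+1 .$$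
   Context: Algorithm RSHTR (parameters: subspace dimension $s\ll n$, $\delta\ge 0$, $\Delta>0$). At iteration $k$, with current point $x_k$, $g_k=\nabla f(x_k)$, $H_k=\nabla^2 f(x_k)$: draw a random matrix $P_k\in\mathbb{R}^{s\times n}$ with i.i.d. $\mathcal{N}(0,1/s)$ entries, independently of all previous draws; set $\tilde g_k=P_kg_k$, $\tilde H_k=P_kH_kP_k^\top$; let $(\tilde v_k,t_k)\in\mathbb{R}^s\times\mathbb{R}$ be an exact minimizer of $$\min_{\|[\tilde v;t]\|\le 1}\begin{bmatrix}\tilde v\\ t\end{bmatrix}^\top\begin{bmatrix}\tilde H_k&\tilde g_k\\ \tilde g_k^\top&-\delta\end{bmatrix}\begin{bmatrix}\tilde v\\ t\end{bmatrix};$$ set $d_k=P_k^\top\tilde v_k/t_k$ if $t_k\neq0$ and $d_k=P_k^\top\tilde v_k$ if $t_k=0$. If $\|d_k\|>\Delta$, set $x_{k+1}=x_k+\frac{\Delta}{\|d_k\|}d_k$ and continue; if $\|d_k\|\le\Delta$, terminate and output $x_k$. (The iteration cap is taken large enough not to interfere.) Absolute constants: $\mathcal{C}$ is such that a random $s\times n$ matrix $P$ with i.i.d. $\mathcal{N}(0,1/s)$ entries satisfies, with probability at least $1-2e^{-s}$, $(\sqrt{n/s}-\mathcal{C})\|y\|\le\|P^\top y\|\le(\sqrt{n/s}+\mathcal{C})\|y\|$ for all $y\in\mathbb{R}^s$. $C$ is such that for each fixed $x\in\mathbb{R}^n$ and $\xi\in(0,1)$, $(1-\xi)\|x\|\le\|Px\|\le(1+\xi)\|x\|$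 with probability at least $1-2\exp(-C\xi^2s)$. Conventions: $s=O(n\varepsilon^{1/\tau})$ means $s\le c\,n\varepsilon^{1/\tau}$ for a constant $c>0$. A point $\hat x$ is an $\varepsilon$-FOSP (approximate first-order stationary point) if $\|\nabla f(\hat x)\|\le O(\varepsilon)$; when the dependence on $n$ and $s$ is made explicit, this means $\|\nabla f(\hat x)\|\le K(n/s)^{(2+\tau)/2}\varepsilon$ with $K$ depending only on $L,M,\tau,c$ and absolute constants. The constant in $O(\varepsilon^{-3/2})$ depends only on $M$ and $f(x_0)-\inf f$. The standing assumption $s\ll n$ means that $n/s$ is at least a suitable absolute constant (in particular $\sqrt{n/s}>\mathcal{C}$). *)

(* Defs.v *)
From HB Require Import structures.
From mathcomp Require Import all_boot all_order all_algebra.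
From mathcomp Require Import all_classical all_reals all_analysis.

Set Implicit Arguments.
Unset Strict Implicit.
Unset Printing Implicit Defensive.

Import Order.TTheory GRing.Theory Num.Theory.
Import numFieldNormedType.Exports.

Local Open Scope classical_set_scope.
Local Open Scope ring_scope.

Section calculus.
Context {R : realType}.

(* The norm that matrices carry in the library, `|x|, is the max norm. *)
Definition enorm {n : nat} (x : 'cV[R]_n) : R :=
  Num.sqrt (\sum_(i < n) x i 0 ^+ 2).

(* Operator norm induced by [enorm]. *)
Definition opnorm {m n : nat} (A : 'M[R]_(m, n)) : R :=
  sup [set enorm (A *m y) | y in [set y : 'cV[R]_n | enorm y <= 1]].

Definition grad {n : nat} (f : 'cV[R]_n -> R) (x : 'cV[R]_n) : 'cV[R]_n :=
  \col_(i < n) 'D_(delta_mx i 0) f x.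

Definition hess {n : nat} (f : 'cV[R]_n -> R) (x : 'cV[R]_n) : 'M[R]_n :=
  \matrix_(i < n, j < n) 'D_(delta_mx j 0) (fun y => grad f y i 0) x.

Definition C2 {n : nat} (f : 'cV[R]_n -> R) : Prop :=
  [/\ forall x, differentiable f x,
      forall x, differentiable (grad f) x
    & continuous (hess f)].

End calculus.

Section random_matrices.
Context {R : realType} {d : measure_display} {T : measurableType d}
        (Pr : probability T R).

(* The product rule over arbitrary Borel sets (some possibly equal to setT)
   is mutual independence of the finite family of entries. The second
   parameter of [normal_prob] is the standard deviation. *)
Definition gaussian_matrix {s n : nat} (X : 'I_s -> 'I_n -> {RV Pr >-> R}) :
    Prop :=
  (forall i j (B : set R), measurable B ->
     distribution Pr (X i j) B = normal_prob 0 (Num.sqrt s%:R^-1) B) /\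
  (forall B : 'I_s -> 'I_n -> set R, (forall i j, measurable (B i j)) ->
     Pr [set w | forall i j, B i j (X i j w)] =
     (\prod_(i < s) \prod_(j < n) Pr (X i j @^-1` B i j))%E).

Definition rv_mx {s n : nat} (X : 'I_s -> 'I_n -> {RV Pr >-> R}) (w : T) :
  'M[R]_(s, n) := \matrix_(i, j) X i j w.

Definition rv_col {s : nat} (X : 'I_s -> {RV Pr >-> R}) (w : T) :
  'cV[R]_s := \col_i X i w.

Definition rv_events (X : {RV Pr >-> R}) : set (set T) :=
  preimage_set_system setT X measurable.

Definition indep_events (F G : set (set T)) : Prop :=
  forall A B, F A -> G B -> Pr (A `&` B) = (Pr A * Pr B)%E.

End random_matrices.

(* The two absolute constants are uniform in the dimensions s <= n. *)
Definition sing_val_const {R : realType} (Cs : R) : Prop :=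
  forall (s n : nat) (d : measure_display) (T : measurableType d)
    (Pr : probability T R) (X : 'I_s -> 'I_n -> {RV Pr >-> R}),
  (0 < s <= n)%N -> gaussian_matrix X ->
  ((1 - 2 * expR (- s%:R))%:E <=
   Pr [set w | forall y : 'cV[R]_s,
         ((Num.sqrt (n%:R / s%:R) - Cs) * enorm y
           <= enorm ((rv_mx X w)^T *m y)
           <= (Num.sqrt (n%:R / s%:R) + Cs) * enorm y)%R])%E.

Definition JL_const {R : realType} (C : R) : Prop :=
  forall (s n : nat) (d : measure_display) (T : measurableType d)
    (Pr : probability T R) (X : 'I_s -> 'I_n -> {RV Pr >-> R})
    (x : 'cV[R]_n) (xi : R),
  (0 < s <= n)%N -> gaussian_matrix X -> 0 < xi < 1 ->
  ((1 - 2 * expR (- (C * xi ^+ 2 * s%:R)))%:E <=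
   Pr [set w | ((1 - xi) * enorm x
                  <= enorm (rv_mx X w *m x)
                  <= (1 + xi) * enorm x)%R])%E.

Section algorithm.
Context {R : realType}.

Definition qform {m : nat} (A : 'M[R]_m) (z : 'cV[R]_m) : R :=
  (z^T *m A *m z) 0 0.

Definition aggregated_mx {s : nat} (H : 'M[R]_s) (g : 'cV[R]_s) (delta : R) :
  'M[R]_(s + 1) := block_mx H g g^T (- delta)%:M.

Definition subproblem_sol {s : nat} (H : 'M[R]_s) (g : 'cV[R]_s) (delta : R)
    (v : 'cV[R]_s) (t : R) : Prop :=
  enorm (col_mx v t%:M : 'cV[R]_(s + 1)) <= 1 /\
  forall (v' : 'cV[R]_s) (t' : R),
    enorm (col_mx v' t'%:M : 'cV[R]_(s + 1)) <= 1 ->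
    qform (aggregated_mx H g delta) (col_mx v t%:M)
      <= qform (aggregated_mx H g delta) (col_mx v' t'%:M).

Definition direction {s n : nat} (P : 'M[R]_(s, n)) (v : 'cV[R]_s) (t : R) :
    'cV[R]_n :=
  if t == 0 then P^T *m v else t^-1 *: (P^T *m v).

End algorithm.

(* P k, v k, t k are the sketching matrix and the subproblem solution of
   iteration k. The sequences are infinite for convenience only: [rshtr_run]
   imposes nothing on v k, t k once the algorithm has terminated. *)
Section runs.
Context {R : realType} {d : measure_display} {T : measurableType d}
        {Pr : probability T R} {s n : nat}.
Variables (x0 : 'cV[R]_n) (Delta : R).
Variables (P : nat -> 'I_s -> 'I_n -> {RV Pr >-> R})
          (v : nat -> 'I_s -> {RV Pr >-> R})
          (t : nat -> {RV Pr >-> R}).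

Definition dir (k : nat) (w : T) : 'cV[R]_n :=
  direction (rv_mx (P k) w) (rv_col (v k) w) (t k w).

Fixpoint iterate (k : nat) (w : T) : 'cV[R]_n :=
  if k is j.+1 then
    if Delta < enorm (dir j w)
    then iterate j w + (Delta / enorm (dir j w)) *: dir j w
    else iterate j w
  else x0.

(* Iteration k is reached: no termination in iterations 0, ..., k - 1. *)
Definition reached (k : nat) (w : T) : Prop :=
  forall j : nat, (j < k)%N -> Delta < enorm (dir j w).

Definition terminates_at (k : nat) (w : T) : Prop :=
  reached k w /\ enorm (dir k w) <= Delta.

(* Events determined by the draws and subproblem solutions before iteration
   k. *)
Definition past (k : nat) : set (set T) :=
  <<s \bigcup_(j in `I_k)
        ((\bigcup_i \bigcup_l rv_events (P j i l)) `|`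
         (\bigcup_i rv_events (v j i)) `|`
         rv_events (t j)) >>.

Definition draw_events (k : nat) : set (set T) :=
  <<s \bigcup_i \bigcup_l rv_events (P k i l) >>.

(* Independence of P k from [past k] forbids that the choice among several
   minimizers of an earlier subproblem anticipates later draws; no other
   restriction is put on that choice. *)
Record rshtr_run (f : 'cV[R]_n -> R) (delta : R) : Prop := RSHTRRun {
  run_gaussian : forall k, gaussian_matrix (P k);
  run_indep : forall k, indep_events Pr (past k) (draw_events k);
  run_sol : forall k w, reached k w ->
    let Pk := rv_mx (P k) w in
    let xk := iterate k w in
    subproblem_sol (Pk *m hess f xk *m Pk^T) (Pk *m grad f xk) delta
      (rv_col (v k) w) (t k w)
}.

End runs.

(* Main.v *)
Require Import Defs.
From mathcomp Require Import all_boot all_order all_algebra.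
From mathcomp Require Import all_classical all_reals all_analysis.
From mathcomp Require Import measurable_realfun ring lra.
Import Order.TTheory GRing.Theory Num.Theory.
Import numFieldNormedType.Exports.
Local Open Scope classical_set_scope.
Local Open Scope ring_scope.

(* If every sketch used by the first U iterations has singular values in
   [[sqrt(n/s) - Cs, sqrt(n/s) + Cs]], the optimality conditions of the
   homogenized subproblem and the Lipschitz Hessian make every non-terminating
   step decrease f by eps^(3/2) / (3 M^2), so that the method stops before
   iteration U; at termination they give |P_k g_k| = O(sqrt(n/s) sqrt(eps)), and
   the condition s <= c n eps^(1/tau) turns a factor sqrt(eps) into
   (n/s)^(tau/2) eps.

   The lower bound |g_k| = O(|P_k g_k|) is needed at a random iteration, and U
   times the failure probability of the Johnson-Lindenstrauss bound may exceed
   the probability budget. It is replaced by the Gaussian small-ball estimate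
   Pr(|P x| < exp(-5/2) |x|) <= exp(-2 s): summed over U iterations it costs at
   most exp(-s), since the claim is void when (2 U + 2) exp(-s) >= 1. *)

Set Implicit Arguments.
Unset Strict Implicit.
Unset Printing Implicit Defensive.

(** * Euclidean norm and the trust-region subproblem *)

Section euclidean.
Context {R : realType}.
Implicit Types n m s : nat.

(** The stopping test only says that [d] is short. The multiplier [lambda] of the subproblem is at
    least [delta] but has no a priori upper bound, so stationarity alone does not control the
    sketched gradient. The [t]-component of the optimality conditions gives
    [lambda = delta - <P g, v / t>]; the part of [lambda * |v / t|] proportional to [|P g|] then has
    coefficient at most [Delta ^+ 2 <= 1 / 8] and is absorbed on the left.

    In the small-ball estimate the radius can be traded against the rate: shrinking the factor in
    front of [|x|] makes the exponential decay as fast as desired, here twice the rate of the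
    budget, whereas a distortion bound with [xi < 1] cannot decay faster than [exp(- C s)]. The lost
    factor only enters the FOSP constant.

    The gradient at iteration [k] is random, but it is a function of the past, from which [P k] is
    independent; an estimate for fixed vectors transfers to it by Tonelli. This is why measurability
    of the iterates is tracked with respect to the past and not only to the ambient
    sigma-algebra. *)

Definition edot {n} (x y : 'cV[R]_n) : R := \sum_(i < n) x i 0 * y i 0.

Lemma edotC n (x y : 'cV[R]_n) : edot x y = edot y x.
Proof. by apply: eq_bigr => i _; rewrite mulrC. Qed.

Lemma edotDl n (x y z : 'cV[R]_n) : edot (x + y) z = edot x z + edot y z.
Proof. by rewrite -big_split; apply: eq_bigr => i _; rewrite mxE mulrDl. Qed.

Lemma edotZl n a (x y : 'cV[R]_n) : edot (a *: x) y = a * edot x y.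
Proof. by rewrite mulr_sumr; apply: eq_bigr => i _; rewrite mxE mulrA. Qed.

Lemma edotDr n (x y z : 'cV[R]_n) : edot z (x + y) = edot z x + edot z y.
Proof. by rewrite edotC edotDl !(edotC z). Qed.

Lemma edotZr n a (x y : 'cV[R]_n) : edot x (a *: y) = a * edot x y.
Proof. by rewrite edotC edotZl edotC. Qed.

Lemma edot0l n (x : 'cV[R]_n) : edot 0 x = 0.
Proof. by rewrite -(scale0r x) edotZl mul0r. Qed.

Lemma edotE n (x y : 'cV[R]_n) : edot x y = (x^T *m y) 0 0.
Proof. by rewrite mxE; apply: eq_bigr => i _; rewrite mxE. Qed.

Lemma edot_mulmxl n m (A : 'M[R]_(m, n)) (x : 'cV[R]_n) (y : 'cV[R]_m) :
  edot (A *m x) y = edot x (A^T *m y).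
Proof. by rewrite !edotE trmx_mul mulmxA. Qed.

Lemma edotxx_ge0 n (x : 'cV[R]_n) : 0 <= edot x x.
Proof. by apply: sumr_ge0 => i _; rewrite -expr2 sqr_ge0. Qed.

Lemma enormE n (x : 'cV[R]_n) : enorm x = Num.sqrt (edot x x).
Proof. by congr Num.sqrt; apply: eq_bigr => i _; rewrite expr2. Qed.

Lemma enorm_ge0 n (x : 'cV[R]_n) : 0 <= enorm x.
Proof. exact: sqrtr_ge0. Qed.

Lemma sqr_enorm n (x : 'cV[R]_n) : enorm x ^+ 2 = edot x x.
Proof. by rewrite enormE sqr_sqrtr ?edotxx_ge0. Qed.

Lemma enorm0 n : enorm (0 : 'cV[R]_n) = 0.
Proof. by rewrite enormE edot0l sqrtr0. Qed.

Lemma enorm_eq0 n (x : 'cV[R]_n) : enorm x = 0 -> x = 0.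
Proof.
move=> x0; have /eqP := sqr_enorm x; rewrite x0 expr0n /= eq_sym.
rewrite psumr_eq0 => [/allP x_eq0|i _]; last by rewrite -expr2 sqr_ge0.
apply/matrixP => i j; rewrite (ord1 j) mxE; apply/eqP.
by have := x_eq0 i; rewrite mem_index_enum => /(_ isT); rewrite mulf_eq0 orbb.
Qed.

Lemma enormZ n a (x : 'cV[R]_n) : enorm (a *: x) = `|a| * enorm x.
Proof.
by rewrite !enormE edotZl edotZr mulrA -expr2 sqrtrM ?sqr_ge0 // sqrtr_sqr.
Qed.

Lemma enormN n (x : 'cV[R]_n) : enorm (- x) = enorm x.
Proof. by rewrite -scaleN1r enormZ normrN1 mul1r. Qed.

Lemma edot_le n (x y : 'cV[R]_n) : edot x y <= enorm x * enorm y.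
Proof.
have [/eqP/enorm_eq0->|x0] := boolP (enorm x == 0).
  by rewrite edot0l enorm0 mul0r.
have [/eqP/enorm_eq0->|y0] := boolP (enorm y == 0).
  by rewrite edotC edot0l enorm0 mulr0.
have xy_gt0 : 0 < enorm x * enorm y by rewrite mulr_gt0 // lt_def enorm_ge0 ?x0 ?y0.
have := edotxx_ge0 (enorm y *: x - enorm x *: y).
rewrite -scaleNr edotDl !edotDr !edotZl !edotZr -!sqr_enorm (edotC y x).
move=> h; rewrite -(ler_pM2l xy_gt0); move: h; nra.
Qed.

Lemma edot_ge n (x y : 'cV[R]_n) : - (enorm x * enorm y) <= edot x y.
Proof.
by rewrite lerNl -mulN1r -edotZl scaleN1r (le_trans (edot_le _ _)) // enormN.
Qed.

Lemma enormD n (x y : 'cV[R]_n) : enorm (x + y) <= enorm x + enorm y.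
Proof.
rewrite -(@ler_pXn2r _ 2) ?nnegrE ?addr_ge0 ?enorm_ge0 //.
rewrite sqrrD !sqr_enorm edotDl !edotDr (edotC y x).
by have := edot_le x y; lra.
Qed.

(** A matrix and its transpose have the same norm: [|P x|^2 = <x, P^T (P x)>], then
    Cauchy-Schwarz. *)
Lemma enorm_mulmx_le n s (P : 'M[R]_(s, n)) b (x : 'cV[R]_n) : 0 <= b ->
  (forall y, enorm (P^T *m y) <= b * enorm y) -> enorm (P *m x) <= b * enorm x.
Proof.
move=> b0 Pb; have [/eqP->|Px0] := boolP (enorm (P *m x) == 0).
  by rewrite mulr_ge0 ?enorm_ge0.
have Px_gt0 : 0 < enorm (P *m x) by rewrite lt_def Px0 enorm_ge0.
rewrite -(ler_pM2r Px_gt0) -expr2 sqr_enorm edot_mulmxl.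
apply: (le_trans (edot_le _ _)); rewrite -mulrA mulrCA.
by rewrite ler_wpM2l ?enorm_ge0.
Qed.

Lemma ler_norm_enorm n (x : 'cV[R]_n) i : `|x i 0| <= enorm x.
Proof.
rewrite -(@ler_pXn2r _ 2) ?nnegrE ?enorm_ge0 // sqr_enorm real_normK ?num_real //.
by rewrite /edot (bigD1 i) //= -expr2 lerDl sumr_ge0 // => j _; rewrite -expr2 sqr_ge0.
Qed.

Lemma enorm_le_sum n (x : 'cV[R]_n) : enorm x <= \sum_i `|x i 0|.
Proof.
rewrite -(@ler_pXn2r _ 2) ?nnegrE ?enorm_ge0 ?sumr_ge0 // sqr_enorm expr2 mulr_suml.
apply: ler_sum => i _; rewrite (le_trans (ler_norm _)) // normrM ler_wpM2l //.
by rewrite (bigD1 i) //= lerDl sumr_ge0.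
Qed.

(** [opnorm] is a [sup], so it dominates its elements only once the set is known to be bounded; the
    sum of the absolute entries is a sufficient bound. *)
Lemma enorm_le_opnorm m n (A : 'M[R]_(m, n)) (y : 'cV[R]_n) :
  enorm (A *m y) <= opnorm A * enorm y.
Proof.
have ub : has_ubound [set enorm (A *m z) | z in [set z : 'cV[R]_n | enorm z <= 1]].
  exists (\sum_i \sum_j `|A i j|) => _ [z /= z1 <-].
  apply: (le_trans (enorm_le_sum _)); apply: ler_sum => i _.
  rewrite mxE (le_trans (ler_norm_sum _ _ _)) //; apply: ler_sum => j _.
  by rewrite normrM ler_piMr // (le_trans (ler_norm_enorm _ _)).
have [/eqP/enorm_eq0->|y0] := boolP (enorm y == 0).
  by rewrite mulmx0 !enorm0 mulr0.
have y_gt0 : 0 < enorm y by rewrite lt_def y0 enorm_ge0.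
have : enorm (A *m ((enorm y)^-1 *: y)) <= opnorm A.
  apply: ub_le_sup => //; exists ((enorm y)^-1 *: y) => //=.
  by rewrite enormZ ger0_norm ?invr_ge0 ?enorm_ge0 // mulVf.
rewrite -scalemxAr enormZ ger0_norm ?invr_ge0 ?enorm_ge0 //.
by rewrite mulrC ler_pdivrMr.
Qed.

End euclidean.

Section subproblem.
Context {R : realType}.

Definition quad {n} (H : 'M[R]_n) (x : 'cV[R]_n) : R := edot x (H *m x).

Lemma quadZ n (H : 'M[R]_n) a x : quad H (a *: x) = a ^+ 2 * quad H x.
Proof. by rewrite /quad -scalemxAr edotZl edotZr mulrA. Qed.

Lemma sqr_enorm_col_mx s (v : 'cV[R]_s) (t : R) :
  enorm (col_mx v t%:M : 'cV[R]_(s + 1)) ^+ 2 = enorm v ^+ 2 + t ^+ 2.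
Proof.
rewrite !sqr_enorm /edot big_split_ord /=; congr (_ + _).
  by apply: eq_bigr => i _; rewrite !col_mxEu.
by rewrite big_ord1 !col_mxEd !mxE eqxx mulr1n.
Qed.

Lemma qform_aggregated s (H : 'M[R]_s) (g : 'cV[R]_s) delta v t :
  qform (aggregated_mx H g delta) (col_mx v t%:M) =
  quad H v + 2 * t * edot g v - delta * t ^+ 2.
Proof.
rewrite /qform /aggregated_mx -mulmxA mul_block_col tr_col_mx mul_row_col.
rewrite tr_scalar_mx mul_mx_scalar mxE mulmxDr mxE -!scalemxAr.
rewrite [X in X + _ + _](_ : _ = quad H v); last by rewrite /quad edotE mulmxA.
rewrite mxE -edotE (edotC _ v) mul_scalar_mx !mxE.
rewrite (_ : \sum_j g^T 0 j * v j 0 = edot g v); last first.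
  by apply: eq_bigr => i _; rewrite mxE.
by rewrite big_ord1 !mxE eqxx !mulr1n (edotC v); ring.
Qed.

(* Stated with the symmetric part of [H], so that symmetry of second
   derivatives is never needed. *)
Lemma subproblem_sol_kkt s (H : 'M[R]_s) (g : 'cV[R]_s) delta v t : 0 < delta ->
  subproblem_sol H g delta v t ->
  exists2 lambda, delta <= lambda &
    [/\ enorm v ^+ 2 + t ^+ 2 = 1,
        2^-1 *: (H *m v + H^T *m v) + lambda *: v + t *: g = 0
      & edot g v = (delta - lambda) * t].
Proof.
move=> delta_gt0 [z_le1 z_min].
pose q v' t' := quad H v' + 2 * t' * edot g v' - delta * t' ^+ 2.
have {}z_min v' t' : enorm v' ^+ 2 + t' ^+ 2 <= 1 -> q v t <= q v' t'.
  move=> z'1; have := z_min v' t'; rewrite !qform_aggregated; apply.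
  by rewrite -(@ler_pXn2r _ 2) ?nnegrE ?enorm_ge0 // sqr_enorm_col_mx expr1n.
have {}z_le1 : enorm v ^+ 2 + t ^+ 2 <= 1.
  by rewrite -sqr_enorm_col_mx expr_le1 ?enorm_ge0.
have q_le : q v t <= - delta.
  rewrite (le_trans (z_min 0 1 _)) //; first by rewrite enorm0; lra.
  by rewrite /q /quad edot0l edotC edot0l; lra.
(* Minimality on the unit ball extends to all vectors by scaling to the unit sphere, since [q] is
   homogeneous of degree 2. *)
have q_homog v' t' : q v t * (enorm v' ^+ 2 + t' ^+ 2) <= q v' t'.
  set N := enorm v' ^+ 2 + t' ^+ 2.
  have [N0|N0] := eqVneq N 0.
    have [v0 t0] : enorm v' = 0 /\ t' = 0.
      move/eqP: N0; rewrite paddr_eq0 ?sqr_ge0 // !sqrf_eq0.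
      by move=> /andP[/eqP-> /eqP->].
    by rewrite N0 t0 (enorm_eq0 v0) /q /quad edot0l; lra.
  have N_gt0 : 0 < N by rewrite lt_def N0 addr_ge0 ?sqr_ge0.
  have sN_gt0 : 0 < Num.sqrt N by rewrite sqrtr_gt0.
  have a2 : (Num.sqrt N)^-1 ^+ 2 = N^-1 by rewrite exprVn sqr_sqrtr // ltW.
  have := z_min ((Num.sqrt N)^-1 *: v') ((Num.sqrt N)^-1 * t').
  rewrite enormZ !exprMn real_normK ?num_real // a2 -mulrDr mulVf // => /(_ (lexx _)).
  have -> : q ((Num.sqrt N)^-1 *: v') ((Num.sqrt N)^-1 * t') = N^-1 * q v' t'.
    by rewrite /q quadZ edotZr -a2; ring.
  by rewrite mulrC ler_pdivlMr.
(* The constraint is active: the optimal value is at most [- delta < 0], so a minimizer inside the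
   ball could be improved by scaling it up. *)
have N1 : enorm v ^+ 2 + t ^+ 2 = 1.
  by apply/eqP; rewrite eq_le z_le1 /=; have := q_homog v t; nra.
(* The multiplier is the opposite of the optimal value, an eigenvalue of the symmetrized aggregated
   matrix. *)
exists (- q v t); first by rewrite lerNr.
set lambda := - q v t; set e := _ + _ + _ : 'cV[R]_s.
have lambda_homog v' t' : 0 <= q v' t' + lambda * (enorm v' ^+ 2 + t' ^+ 2).
  by rewrite /lambda mulNr subr_ge0.
(* The shifted form [q + lambda * |.|^2] is nonnegative and vanishes at [(v, t)], so its first-order
   variation [2 * B] in any direction [(w, tau)] is zero. *)
have stationary w tau : edot w e + tau * (edot g v - (delta - lambda) * t) = 0.
  set B := LHS.
  have h a : 0 <= 2 * a * B +
      a ^+ 2 * (q w tau + lambda * (enorm w ^+ 2 + tau ^+ 2)).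
    suff <- : q (v + a *: w) (t + a * tau) +
        lambda * (enorm (v + a *: w) ^+ 2 + (t + a * tau) ^+ 2) =
        2 * a * B + a ^+ 2 * (q w tau + lambda * (enorm w ^+ 2 + tau ^+ 2)) by [].
    transitivity (q v t + lambda * (enorm v ^+ 2 + t ^+ 2) +
        (2 * a * B + a ^+ 2 * (q w tau + lambda * (enorm w ^+ 2 + tau ^+ 2)))).
      rewrite /B /q /quad /e !sqr_enorm mulmxDr -scalemxAr.
      rewrite !(edotDl, edotDr, edotZl, edotZr).
      rewrite (edotC w (H^T *m v)) edot_mulmxl trmxK (edotC w v) (edotC w g).
      by field.
    by rewrite N1 /lambda; ring.
  set Q := _ + lambda * _ in h.
  have Q0 : 0 <= Q by have := lambda_homog w tau; rewrite /Q; lra.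
  apply/eqP; apply/negPn/negP => B0.
  have Q1 : 0 < Q + 1 by lra.
  (* This step length makes the variation negative when [B] is nonzero; the denominator is [Q + 1]
     because [Q] may vanish. *)
  have := h (- B / (Q + 1)).
  have -> : 2 * (- B / (Q + 1)) * B + (- B / (Q + 1)) ^+ 2 * Q =
      - (B ^+ 2 * ((Q + 2) / (Q + 1) ^+ 2)).
    by field; rewrite gt_eqF.
  rewrite oppr_ge0 leNgt mulr_gt0 //; first by rewrite exprn_even_gt0.
  by rewrite divr_gt0 ?exprn_gt0 //; lra.
split => //.
- have := stationary e 0; rewrite mul0r addr0 -sqr_enorm => /eqP.
  by rewrite sqrf_eq0 => /eqP/enorm_eq0.
- by have := stationary 0 1; rewrite edot0l; lra.
Qed.

Variables (s n : nat) (P : 'M[R]_(s, n)) (H : 'M[R]_n) (g : 'cV[R]_n).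
Variables (sigma delta Delta : R) (v : 'cV[R]_s) (t : R).
Hypotheses (delta_gt0 : 0 < delta) (Delta_gt0 : 0 < Delta).
Hypotheses (sigma_gt0 : 0 < sigma)
  (P_le : forall y, enorm (P^T *m y) <= sigma * enorm y).
Hypothesis sol : subproblem_sol (P *m H *m P^T) (P *m g) delta v t.

Let d := direction P v t.

(* [y] is [v / t], or [v] when [t = 0]. *)
Lemma direction_kkt : exists (y : 'cV[R]_s) (lambda : R),
  [/\ d = P^T *m y, delta <= lambda,
      t = 0 -> enorm y = 1,
      t != 0 -> 2^-1 *: (P *m (H *m d) + P *m (H^T *m d)) + lambda *: y = - (P *m g) /\
        edot (P *m g) y = delta - lambda
    & edot g d <= 0 /\ quad H d + lambda * enorm y ^+ 2 <= - edot g d].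
Proof.
have [lambda lambda_ge [N1 stat gv]] := subproblem_sol_kkt delta_gt0 sol.
have tr : (P *m H *m P^T)^T = P *m H^T *m P^T by rewrite !trmx_mul trmxK mulmxA.
rewrite tr -!mulmxA in stat.
(* The antisymmetric part of [H] does not contribute to the quadratic form, so the symmetrized
   stationarity equation gives the curvature of [H] itself along [P^T y]. *)
have quadP (y : 'cV[R]_s) : quad H (P^T *m y) =
    edot y (2^-1 *: (P *m (H *m (P^T *m y)) + P *m (H^T *m (P^T *m y)))).
  have PE x : edot y (P *m x) = edot (P^T *m y) x by rewrite edot_mulmxl trmxK.
  rewrite /quad edotZr edotDr !PE -(edot_mulmxl H) (edotC (H *m _)).
  by field.
have [t0|t0] := eqVneq t 0.
- exists v, lambda; rewrite /d /direction t0 eqxx.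
  have v1 : enorm v = 1.
    apply/eqP; rewrite -(@pexpr_eq1 _ _ 2) ?enorm_ge0 //; apply/eqP.
    by move: N1; rewrite t0; lra.
  have gd : edot g (P^T *m v) = 0 by rewrite -edot_mulmxl gv t0 mulr0.
  split => //; split; first by rewrite gd.
  rewrite gd quadP; move: stat; rewrite t0 scale0r addr0.
  move/eqP; rewrite addr_eq0 => /eqP ->.
  by rewrite -scaleNr edotZr -sqr_enorm; lra.
- exists (t^-1 *: v), lambda; rewrite /d /direction (negbTE t0).
  have gy : edot (P *m g) (t^-1 *: v) = delta - lambda by rewrite edotZr gv; field.
  have stat' : 2^-1 *: (P *m (H *m (P^T *m (t^-1 *: v))) +
      P *m (H^T *m (P^T *m (t^-1 *: v)))) + lambda *: (t^-1 *: v) = - (P *m g).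
    apply/eqP; rewrite -subr_eq0 opprK; apply/eqP.
    have := congr1 ( *:%R t^-1) stat.
    rewrite scaler0 => <-; rewrite -!scalemxAr !scalerDr !scalerA mulVf // scale1r.
    by rewrite (mulrC t^-1 2^-1) (mulrC t^-1 lambda).
  have gd : edot g (P^T *m (t^-1 *: v)) = delta - lambda by rewrite -edot_mulmxl.
  rewrite !scalemxAr; split => //.
    by move=> /eqP; rewrite (negbTE t0).
  split; first by rewrite gd; lra.
  have := congr1 (edot (t^-1 *: v)) stat'.
  rewrite edotDr -quadP edotZr -sqr_enorm -[in RHS]scaleN1r edotZr (edotC _ (P *m g)).
  by rewrite edot_mulmxl; lra.
Qed.

(** With [eta = Delta / |d| < 1], the model value is at most [eta * (1 - eta / 2) * <g, d> - lambda
    * eta^2 * |y|^2 / 2]. The first term is nonpositive. In the second,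
    [lambda >= delta = sigma^2 * e] and [Delta = eta * |d| <= eta * sigma * |y|]: the factor
    [sigma^2] in [delta] compensates the stretching by [P^T]. *)
Lemma model_decrease e : delta = sigma ^+ 2 * e -> 0 < e -> Delta < enorm d ->
  let u := (Delta / enorm d) *: d in
  enorm u = Delta /\ edot g u + quad H u / 2 <= - (e * Delta ^+ 2 / 2).
Proof.
move=> deltaE e0 d_gt u.
have [y [lambda [dE lambda_ge _ _ [gd_le0 quad_le]]]] := direction_kkt.
have d_gt0 : 0 < enorm d by exact: lt_trans d_gt.
have eta0 : 0 < Delta / enorm d by rewrite divr_gt0.
have eta1 : Delta / enorm d < 1 by rewrite ltr_pdivrMr // mul1r.
have uD : enorm u = Delta by rewrite enormZ gtr0_norm // divfK ?gt_eqF.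
split=> //; rewrite /u edotZr quadZ.
have etad : Delta / enorm d * enorm d = Delta by rewrite divfK ?gt_eqF.
have dy : enorm d <= sigma * enorm y by rewrite dE.
set eta := Delta / enorm d in eta0 eta1 etad *.
have D_le : Delta <= eta * (sigma * enorm y) by rewrite -etad ler_pM2l.
have D2_le : Delta ^+ 2 <= eta ^+ 2 * (sigma ^+ 2 * enorm y ^+ 2).
  rewrite -!exprMn ler_pXn2r ?nnegrE //; first exact: ltW.
  by rewrite (le_trans _ D_le) // ltW.
have : eta ^+ 2 * quad H d <= eta ^+ 2 * (- edot g d - lambda * enorm y ^+ 2).
  by rewrite ler_wpM2l ?sqr_ge0 //; lra.
have : eta ^+ 2 * enorm y ^+ 2 * delta <= eta ^+ 2 * enorm y ^+ 2 * lambda.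
  by rewrite ler_wpM2l // mulr_ge0 ?sqr_ge0.
have : e * Delta ^+ 2 <= e * (eta ^+ 2 * (sigma ^+ 2 * enorm y ^+ 2)).
  by rewrite ler_wpM2l // ltW.
have : edot g d * eta * (2 - eta) <= 0.
  by rewrite -mulrA mulr_le0_ge0 // mulr_ge0 //; lra.
rewrite deltaE; nra.
Qed.

Lemma sketched_grad_le sigma1 L : 1 <= sigma1 -> Delta < 1 -> 0 <= L ->
  (forall y, sigma1 * enorm y <= enorm (P^T *m y)) ->
  (forall x, enorm (H *m x) <= L * enorm x) ->
  enorm d <= Delta ->
  (1 - Delta ^+ 2) * enorm (P *m g) <= (sigma * L + delta / sigma1) * Delta.
Proof.
move=> sigma1_ge1 Delta_lt1 L0 P_ge H_le d_le.
have [y [lambda [dE lambda_ge t_eq0 t_neq0 _]]] := direction_kkt.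
have y_le : enorm y <= Delta / sigma1.
  rewrite ler_pdivlMr; last by lra.
  by rewrite mulrC (le_trans (P_ge _)) // -dE.
have sigma1_gt0 : 0 < sigma1 by lra.
have yD : enorm y <= Delta.
  by rewrite (le_trans y_le) // ler_pdivrMr // ler_peMr // ltW.
(* The case [t = 0] would give [|y| = 1], but a short [d] and the lower singular value bound force
   [|y| <= Delta < 1]. *)
have t0 : t != 0.
  by apply/eqP => /t_eq0 y1; rewrite y1 in yD; lra.
have [stat gy] := t_neq0 t0.
have PT_le x : enorm (P *m x) <= sigma * enorm x.
  by apply: enorm_mulmx_le => //; exact: ltW.
have HT_le x : enorm (H^T *m x) <= L * enorm x.
  by apply: enorm_mulmx_le => // z; rewrite trmxK.
have PHd : enorm (P *m (H *m d)) <= sigma * L * Delta.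
  rewrite (le_trans (PT_le _)) // -mulrA ler_pM2l // (le_trans (H_le _)) //.
  by rewrite ler_wpM2l.
have PHTd : enorm (P *m (H^T *m d)) <= sigma * L * Delta.
  rewrite (le_trans (PT_le _)) // -mulrA ler_pM2l // (le_trans (HT_le _)) //.
  by rewrite ler_wpM2l.
have lambda_gt0 : 0 < lambda by exact: lt_le_trans lambda_ge.
have Pg_le : enorm (P *m g) <= sigma * L * Delta + lambda * enorm y.
  rewrite -enormN -stat (le_trans (enormD _ _)) // lerD //.
    rewrite enormZ ger0_norm; last by rewrite invr_ge0.
    by have := enormD (P *m (H *m d)) (P *m (H^T *m d)); lra.
  by rewrite enormZ gtr0_norm.
(* Multiplied by [|y| <= Delta], the second summand becomes [Delta ^+ 2 * |P g|], the origin of the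
   factor [1 - Delta ^+ 2]. *)
have lambda_le : lambda <= delta + enorm (P *m g) * enorm y.
  by have := edot_ge (P *m g) y; rewrite gy; lra.
have y0 := enorm_ge0 y; have Pg0 := enorm_ge0 (P *m g).
have : lambda * enorm y <= delta * (Delta / sigma1) + enorm (P *m g) * Delta ^+ 2.
  rewrite (le_trans (ler_wpM2r y0 lambda_le)) // mulrDl lerD //.
    by rewrite ler_pM2l.
  by rewrite -mulrA ler_wpM2l // -expr2 ler_pXn2r ?nnegrE // ltW.
by move: Pg_le; rewrite [delta * _]mulrA [delta * _ / _]mulrAC; lra.
Qed.

End subproblem.

(** * Second-order Taylor bound *)

Section calculus.
Context {R : realType}.

Lemma is_derive_line {V W : normedModType R} (F : V -> W) x u s dF :
  is_derive (x + s *: u) u F dF ->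
  is_derive (s : R) 1 (fun r : R => F (x + r *: u)) dF.
Proof.
have E : (fun h : R => h^-1 *: (((fun r : R => F (x + r *: u)) \o shift s) (h *: 1)
                             - F (x + s *: u))) =
         (fun h : R => h^-1 *: ((F \o shift (x + s *: u)) (h *: u) - F (x + s *: u))).
  apply/funext => h /=; congr (_ *: (F _ - _)).
  by rewrite [h *: 1]mulr1 scalerDl addrCA addrA addrAC addrC addrA.
by move=> [dx <-]; split; rewrite /derivable /derive E.
Qed.

Lemma derive_edot_grad n (f : 'cV[R]_n -> R) x u : differentiable f x ->
  'D_u f x = edot (grad f x) u.
Proof.
move=> df; rewrite deriveE // {1}(matrix_sum_delta u) linear_sum; apply: eq_bigr => i _.
by rewrite big_ord1 linearZ /= mulrC mxE deriveE.
Qed.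

Lemma differentiable_entry {V : normedModType R} n (F : V -> 'cV[R]_n) x i :
  differentiable F x -> differentiable (fun y => F y i 0) x.
Proof.
move=> dF; apply: (@differentiable_comp _ _ _ _ F (fun A : 'cV[R]_n => A i 0)) => //.
exact: differentiable_coord.
Qed.

Lemma derive_grad n (f : 'cV[R]_n -> R) x u i : differentiable (grad f) x ->
  'D_u (fun y => grad f y i 0) x = (hess f x *m u) i 0.
Proof.
move=> df; have dfi := differentiable_entry i df.
rewrite deriveE // {1}(matrix_sum_delta u) linear_sum mxE; apply: eq_bigr => j _.
by rewrite big_ord1 linearZ /= mulrC mxE deriveE.
Qed.

Lemma is_derive_edot_grad n (f : 'cV[R]_n -> R) x u w s :
  (forall y, differentiable (grad f) y) ->
  is_derive (s : R) 1 (fun r : R => edot (grad f (x + r *: u)) w)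
    (edot (hess f (x + s *: u) *m u) w).
Proof.
move=> df; apply: (is_derive_line (F := fun y => edot (grad f y) w)).
have -> : (fun y => edot (grad f y) w) =
    \sum_(i < n) (w i 0 \*: (fun y => grad f y i 0)).
  by apply/funext => y; rewrite fct_sumE; apply: eq_bigr => i _; rewrite /= mulrC.
have -> : edot (hess f (x + s *: u) *m u) w =
    \sum_(i < n) w i 0 *: (hess f (x + s *: u) *m u) i 0.
  by apply: eq_bigr => i _; rewrite mulrC.
apply: is_derive_sum => i; apply: is_deriveZ; rewrite -derive_grad //.
by apply/derivableP/diff_derivable/differentiable_entry.
Qed.

(** The gradient is tested against the fixed vector [w = hess f x *m u]: along the line [x + r u],
    the scalar [<grad f, w>] has derivative [|w|^2] at [r = 0], while its difference quotients for
    [r != 0] are at most [L * |u| * |w|]. *)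
Lemma hess_lipschitz_grad n (f : 'cV[R]_n -> R) L :
  (forall y, differentiable (grad f) y) ->
  (forall x y, enorm (grad f x - grad f y) <= L * enorm (x - y)) ->
  forall x u, enorm (hess f x *m u) <= L * enorm u.
Proof.
move=> df gradL x u; set w := hess f x *m u.
have [/eqP w0|w0] := boolP (enorm w == 0).
  have := gradL (x + u) x; rewrite addrAC subrr add0r w0; apply: le_trans.
  exact: enorm_ge0.
have w_gt0 : 0 < enorm w by rewrite lt_def w0 enorm_ge0.
have [dphi dphiE] := is_derive_edot_grad x u w 0 df.
rewrite -(ler_pM2r w_gt0) -expr2 sqr_enorm.
have x0 : x + (0 : R) *: u = x by rewrite scale0r addr0.
rewrite x0 -/w in dphiE; rewrite -dphiE; apply: limr_le => //; near=> h.
have h0 : h != 0 by near: h; exact: nbhs_dnbhs_neq.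
rewrite /= x0 addr0 [h *: 1]mulr1 -[X in _ - X]mul1r -mulNr -edotZl -edotDl scaleN1r.
rewrite -[_ *: edot _ _]edotZl (le_trans (edot_le _ _)) // ler_wpM2r ?enorm_ge0 //.
rewrite enormZ normfV mulrC ler_pdivrMr ?normr_gt0 // (le_trans (gradL _ _)) //.
by rewrite addrAC subrr add0r enormZ mulrA mulrAC.
Unshelve. all: by end_near. Qed.

(** The remainder [psi] along the segment and its derivative [psi1] both vanish at 0, and the
    Lipschitz Hessian makes [psi1] have a nonnegative derivative on [s >= 0]. Two uses of the mean
    value theorem then give [psi 1 >= 0], without an integral remainder. *)
Lemma taylor_hess_lipschitz n (f : 'cV[R]_n -> R) M x u : C2 f ->
  (forall x y, opnorm (hess f x - hess f y) <= M * enorm (x - y)) ->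
  f (x + u) <= f x + edot (grad f x) u + quad (hess f x) u / 2 +
               M / 6 * enorm u ^+ 3.
Proof.
move=> [df dg _] hessM.
set c1 := edot (grad f x) u; set c2 := quad (hess f x) u; set K := M * enorm u ^+ 3.
have dphi s : is_derive (s : R) 1 (fun r : R => f (x + r *: u)) (edot (grad f (x + s *: u)) u).
  by apply: is_derive_line; rewrite -derive_edot_grad //; exact/derivableP/diff_derivable.
have dphi1 s := is_derive_edot_grad x u u s dg.
pose psi1 (s : R) := c1 + c2 * s + K / 2 * s ^+ 2 - edot (grad f (x + s *: u)) u.
pose psi (s : R) := f x + c1 * s + c2 / 2 * s ^+ 2 + K / 6 * s ^+ 3 - f (x + s *: u).
have dpsi1 s : is_derive (s : R) 1 psi1 (c2 + K * s - edot (hess f (x + s *: u) *m u) u).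
  by rewrite /psi1; apply: is_derive_eq; rewrite /GRing.scale /=; field.
have dpsi s : is_derive (s : R) 1 psi (psi1 s).
  by rewrite /psi /psi1; apply: is_derive_eq; rewrite /GRing.scale /=; field.
have x0 : x + (0 : R) *: u = x by rewrite scale0r addr0.
have cont (F dF : R -> R) a b : (forall r : R, is_derive r 1 F (dF r)) ->
    {within `[a, b], continuous F}.
  move=> dF_; apply: continuous_subspaceT => r.
  by apply/differentiable_continuous/derivable1_diffP; case: (dF_ r).
have arith (a b e k : R) :
    a + -1 * b <= e * (M * (k * e) * e) -> 0 <= b + M * e ^+ 3 * k - a.
  by clear; lra.
have psi1_ge0 s : 0 <= s -> 0 <= psi1 s.
  move=> s0.
  have [r /andP[]] := MVT_segment s0 (fun r _ => dpsi1 r) (cont _ _ _ _ dpsi1).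
  rewrite !bnd_simp => r0 _; rewrite [psi1 0]/psi1 x0 subr0.
  have -> : c1 + c2 * 0 + K / 2 * 0 ^+ 2 - edot (grad f x) u = 0 by rewrite /c1; ring.
  rewrite subr0 => ->; rewrite mulr_ge0 //.
  have yx : enorm (x + r *: u - x) = r * enorm u.
    by rewrite addrAC subrr add0r enormZ ger0_norm.
  rewrite edotC /c2 /K /quad; move: (x + r *: u) yx => y yx.
  have : quad (hess f y - hess f x) u <= enorm u * (M * (r * enorm u) * enorm u).
    rewrite (le_trans (edot_le _ _)) // ler_wpM2l ?enorm_ge0 //.
    rewrite (le_trans (enorm_le_opnorm _ _)) // ler_wpM2r ?enorm_ge0 //.
    by rewrite -yx hessM.
  rewrite /quad mulmxBl edotDr -scaleN1r edotZr.
  exact: arith.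
have [r /andP[]] := MVT_segment ler01 (fun r _ => dpsi r) (cont _ _ _ _ dpsi).
rewrite !bnd_simp => r0 _; rewrite /psi x0 scale1r => psiE.
have := psi1_ge0 r r0; move: psiE; rewrite /K.
move: (psi1 r) (enorm u) (f (x + u)) (f x) => p e fu fx.
by clearbody c1 c2; clear -c1 c2; lra.
Qed.

End calculus.

(** * Gaussian small-ball estimate *)

Section gaussian_bump.
Context {R : realType}.
Local Open Scope ereal_scope.

(** The Radon-Nikodym derivative and the explicit density have the same integral over every
    measurable set, hence agree almost everywhere. *)
Lemma integral_normal_prob (m sigma : R) (f : R -> \bar R) :
  (normal_prob m sigma).-integrable setT f ->
  \int[normal_prob m sigma]_x f x =
  \int[lebesgue_measure]_x (f x * (normal_pdf m sigma x)%:E).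
Proof.
move=> fi; rewrite -(Radon_Nikodym_change_of_variables (normal_prob_dominates m sigma)) //.
have mpdf : measurable_fun setT (EFin \o normal_pdf m sigma).
  by apply/measurable_EFinP; exact: measurable_normal_pdf.
have mf := measurable_int _ fi.
apply: ae_eq_integral => //.
- apply: emeasurable_funM => //; apply: measurable_int.
  by apply: Radon_Nikodym_integrable; exact: normal_prob_dominates.
- exact: emeasurable_funM.
- apply: ae_eqe_mul2l; apply: integral_ae_eq => //.
    by apply: Radon_Nikodym_integrable; exact: normal_prob_dominates.
  move=> A _ mA; rewrite -Radon_Nikodym_integral //; exact: normal_prob_dominates.
Qed.

(** An unnormalized centred Gaussian density of variance [v]. Averaging it over a Gaussian shift
    gives a multiple of the same kind of function with a larger variance, so the entries of a sketch
    can be integrated out successively. *)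
Definition gbump (v z : R) : R := expR (- (z ^+ 2 / (2 * v))).

Lemma gbump_ge0 v z : (0 <= gbump v z)%R. Proof. exact: expR_ge0. Qed.

Lemma gbump_le1 v z : (0 < v)%R -> (gbump v z <= 1)%R.
Proof.
by move=> v0; rewrite expR_le1 oppr_le0 divr_ge0 ?sqr_ge0 // mulr_ge0 // ltW.
Qed.

Lemma measurable_gbump v : measurable_fun setT (gbump v).
Proof.
apply: measurableT_comp => //; apply: measurableT_comp => //.
by apply: measurable_funM => //; exact: measurable_funX.
Qed.

(* By completing the square, the integrand is a multiple of a normal density. *)
Lemma integral_gbump_normal (v tau x z : R) : (0 < v)%R -> (0 < tau)%R ->
  \int[normal_prob 0 tau]_g (gbump v (z + x * g))%:E =
  (Num.sqrt (v / (v + x ^+ 2 * tau ^+ 2)) * gbump (v + x ^+ 2 * tau ^+ 2) z)%:E.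
Proof.
move=> v0 tau0.
have mg : measurable_fun setT (fun g : R => gbump v (z + x * g)).
  apply: measurableT_comp; first exact: measurable_gbump.
  by apply: measurable_funD => //; exact: measurable_funM.
rewrite integral_normal_prob; last first.
  apply/integrableP; split; first exact/measurable_EFinP.
  apply: (@le_lt_trans _ _ (\int[normal_prob 0 tau]_g (cst 1%E g))).
    apply: ge0_le_integral => //; first exact/measurable_EFinP/measurableT_comp.
    by move=> g _; rewrite /= lee_fin ger0_norm ?gbump_ge0 ?gbump_le1.
  rewrite integral_cst // mul1e.
  have /= -> := probability_setT (normal_prob 0 tau).
  exact: ltry.
set v' := (v + x ^+ 2 * tau ^+ 2)%R.
have v'0 : (0 < v')%R by rewrite ltr_pwDl // mulr_ge0 ?sqr_ge0.
(* Posterior mean and standard deviation of [g] when [z + x * g] is observed to be 0 with Gaussian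
   noise of variance [v]. *)
pose m' := (- (x * z * tau ^+ 2 / v'))%R.
pose tau' := (tau * Num.sqrt (v / v'))%R.
have sq0 : (0 < Num.sqrt (v / v'))%R by rewrite sqrtr_gt0 divr_gt0.
have tau'0 : (0 < tau')%R by rewrite mulr_gt0.
have tau'2 : (tau' ^+ 2 = tau ^+ 2 * (v / v'))%R.
  by rewrite exprMn sqr_sqrtr // ltW // divr_gt0.
have pdfE g : (gbump v (z + x * g) * normal_pdf 0 tau g =
    Num.sqrt (v / v') * gbump v' z * normal_pdf m' tau' g)%R.
  rewrite !normal_pdfE ?gt_eqF // /normal_fun /gbump.
  have peakE : (normal_peak tau = Num.sqrt (v / v') * normal_peak tau')%R.
    have E : (tau' ^+ 2 * pi *+ 2 = v / v' * (tau ^+ 2 * pi *+ 2))%R.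
      by rewrite tau'2; ring.
    rewrite /normal_peak E (@sqrtrM _ (v / v')) ?ltW ?divr_gt0 //.
    by rewrite invfM mulVKf ?gt_eqF.
  rewrite peakE; set p := normal_peak tau'; set q := Num.sqrt _.
  rewrite mulrCA [RHS]mulrACA -!expRD; congr (_ * expR _)%R.
  rewrite tau'2 /m' /v'; field.
  by rewrite exprMn -/v' !gt_eqF.
transitivity (\int[lebesgue_measure]_g ((Num.sqrt (v / v') * gbump v' z)%:E *
    (normal_pdf m' tau' g)%:E)).
  by apply: eq_integral => g _; rewrite -!EFinM pdfE.
rewrite ge0_integralZl //.
- by rewrite integral_normal_pdf mule1.
- by apply/measurable_EFinP; exact: measurable_normal_pdf.
- by move=> g _; rewrite lee_fin normal_pdf_ge0.
- by rewrite lee_fin mulr_ge0 ?gbump_ge0.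
Qed.
End gaussian_bump.

Section independence.
Context {R : realType} {d : measure_display} {T : measurableType d}
        (Pr : probability T R).
Local Open Scope ereal_scope.

(** The product rule on rectangles identifies the joint law with the product of the marginal laws;
    Tonelli then freezes [X1] while [X2] is averaged. *)
Lemma integral_indep d1 d2 (T1 : measurableType d1) (T2 : measurableType d2)
    (X1 : {mfun T >-> T1}) (X2 : {mfun T >-> T2}) (f : T1 * T2 -> \bar R) :
  (forall A B, measurable A -> measurable B ->
     Pr (X1 @^-1` A `&` X2 @^-1` B) = Pr (X1 @^-1` A) * Pr (X2 @^-1` B)) ->
  measurable_fun setT f -> (forall z, 0 <= f z) ->
  \int[Pr]_w f (X1 w, X2 w) =
  \int[Pr]_w \int[distribution Pr X2]_y f (X1 w, y).
Proof.
move=> X12 mf f0.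
have mX : measurable_fun setT (fun w => (X1 w, X2 w)).
  by apply/measurable_fun_pairP; split; exact: measurable_funP.
pose X : {mfun T >-> (T1 * T2)%type} := mfun_Sub (mem_set mX).
transitivity (\int[distribution Pr X]_z f z).
  by rewrite ge0_integral_distribution.
transitivity (\int[distribution Pr X1 \x distribution Pr X2]_z f z).
  apply: eq_measure_integral => A mA _; apply/esym.
  by apply: product_measure_unique => // B C mB mC; exact: X12.
rewrite fubini_tonelli1 //.
rewrite (ge0_integral_distribution X1 (f := fubini_F (distribution Pr X2) f)) //.
- exact: measurable_fun_fubini_tonelli_F.
- by move=> x; apply: integral_ge0.
Qed.

Lemma g_sigma_algebra_sub (G : set (set T)) : G `<=` measurable ->
  <<s G >> `<=` measurable.
Proof. by move=> GT; apply: smallest_sub => //; exact: sigma_algebra_measurable. Qed.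

(** The identity, seen as a random variable valued in the coarser measurable space, lets
    independence of sigma-algebras be used as independence of two random variables. *)
Lemma measurable_id_g_sigma (G : set (set T)) : G `<=` measurable ->
  measurable_fun setT (id : T -> g_sigma_algebraType G).
Proof. by move=> /g_sigma_algebra_sub GT _ A GA; rewrite setTI; exact: GT. Qed.

Lemma rv_events_measurable (X : {RV Pr >-> R}) : rv_events X `<=` measurable.
Proof. by move=> _ [B mB <-]; exact: measurable_funP. Qed.

Lemma measurable_fun_rv_events (G : set (set T)) (X : {RV Pr >-> R}) :
  rv_events X `<=` G -> measurable_fun setT (X : g_sigma_algebraType G -> R).
Proof. by move=> XG _ B mB; apply: sub_sigma_algebra; apply: XG; exists B. Qed.

Definition mutually_independent {I : finType} (X : I -> {RV Pr >-> R}) : Prop :=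
  forall B : I -> set R, (forall i, measurable (B i)) ->
    Pr [set w | forall i, B i (X i w)] = \prod_i Pr (X i @^-1` B i).

(** Uniqueness of finite measures on a generating pi-system: [A -> Pr (A and X k in C)] and
    [A -> Pr A * Pr (X k in C)] agree on the cylinders over [J], which are stable under
    intersection. *)
Lemma mutually_independent_indep {I : finType} (X : I -> {RV Pr >-> R})
    (J : {pred I}) (k : I) : mutually_independent X -> k \notin J ->
  indep_events Pr <<s \bigcup_(i in [set` J]) rv_events (X i) >> (rv_events (X k)).
Proof.
move=> Xindep kJ A _ FA [C mC <-]; rewrite setTI.
set S := \bigcup_(i in _) _ in FA *.
pose cyl (B : I -> set R) := [set w | forall i, B i (X i w)].
pose PI := [set A : set T | exists B : I -> set R,
  [/\ (forall i, measurable (B i)), (forall i, i \notin J -> B i = setT) & A = cyl B]].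
have cyl_meas B : (forall i, measurable (B i)) -> measurable (cyl B).
  move=> mB; rewrite (_ : cyl B = \bigcap_(i in [set: I]) (X i @^-1` B i)).
    apply: fin_bigcap_measurable => // i _.
    by rewrite -[X in measurable X]setTI; exact: measurable_funP.
  by apply/seteqP; split=> w /= h i => [_|]; exact: h.
have PIC B : (forall i, measurable (B i)) -> (forall i, i \notin J -> B i = setT) ->
    Pr (cyl B `&` X k @^-1` C) = Pr (cyl B) * Pr (X k @^-1` C).
  move=> mB BJ.
  pose B' i := if i == k then C else B i.
  have mB' i : measurable (B' i) by rewrite /B'; case: ifP.
  have -> : cyl B `&` X k @^-1` C = cyl B'.
    apply/seteqP; split=> w /=.
      by move=> [wB wC] i; rewrite /B'; case: eqP => [->|_] //; exact: wB.
    move=> wB'; split; last by have := wB' k; rewrite /B' eqxx.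
    move=> i; have := wB' i; rewrite /B'; case: eqP => [->|_] //.
    by rewrite BJ.
  rewrite !Xindep // (bigD1 k) //= [in RHS](bigD1 k) //=.
  rewrite BJ // preimage_setT probability_setT mul1e muleC.
  rewrite {2}/B' eqxx; congr (_ * _).
  by apply: eq_bigr => i ik; rewrite /B' (negbTE ik).
have mXk : measurable (X k @^-1` C).
  by rewrite -[X in measurable X]setTI; exact: measurable_funP.
have mS : S `<=` PI.
  move=> _ [i iJ [B mB <-]]; rewrite setTI.
  exists (fun j => if j == i then B else setT); split.
  - by move=> j; case: ifP.
  - by move=> j jJ; case: eqP => // ji; move: jJ; rewrite ji; move/negP; rewrite iJ.
  - apply/seteqP; split=> w /=; first by move=> wB j; case: eqP => // ->.
    by move=> /(_ i); rewrite eqxx.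
pose m1 : {measure set T -> \bar R} := mrestr Pr mXk.
pose m2 : {measure set T -> \bar R} :=
  mscale (NngNum (fine_ge0 (measure_ge0 Pr (X k @^-1` C)))) Pr.
have m2E B : m2 B = Pr B * Pr (X k @^-1` C).
  transitivity ((fine (Pr (X k @^-1` C)))%:E * Pr B) => //.
  by rewrite fineK ?fin_num_measure // muleC.
rewrite -m2E; change (m1 A = m2 A).
apply: (g_sigma_algebra_measure_unique PI _ (fun=> setT)).
- by move=> _ [B [mB _ ->]]; exact: cyl_meas.
- by move=> _; exists (fun=> setT); split => //; apply/seteqP; split.
- by apply/seteqP; split=> // w _; exists 0%N.
- move=> _ _ [B [mB BJ ->]] [B' [mB' BJ' ->]].
  exists (fun i => B i `&` B' i); split.
  + by move=> i; exact: measurableI.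
  + by move=> i iJ; rewrite BJ // BJ' // setIT.
  + apply/seteqP; split=> w /=; first by move=> [h h'] i; split.
    by move=> h; split=> i; case: (h i).
- move=> _ [B [mB BJ ->]]; rewrite m2E -PIC //.
- by move=> _; rewrite -ge0_fin_numE // fin_num_measure.
- exact: sub_smallest2r FA.
Qed.

End independence.

Section measurable_bigop.
Context {R : realType} {d : measure_display} {T : measurableType d}.
Variables (D : set T) (I : Type) (r : seq I) (P : pred I) (h : I -> T -> R).
Hypothesis mh : forall i, P i -> measurable_fun D (h i).

Lemma measurable_sum_cond : measurable_fun D (fun w => \sum_(i <- r | P i) h i w).
Proof.
elim: r => [|i r' IHr].
  by under eq_fun do rewrite big_nil; exact: measurable_cst.
case Pi : (P i).
  under eq_fun do rewrite big_cons Pi.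
  by apply: measurable_funD => //; exact: mh.
by under eq_fun do rewrite big_cons Pi.
Qed.

Lemma measurable_prod_cond : measurable_fun D (fun w => \prod_(i <- r | P i) h i w).
Proof.
elim: r => [|i r' IHr].
  by under eq_fun do rewrite big_nil; exact: measurable_cst.
case Pi : (P i).
  under eq_fun do rewrite big_cons Pi.
  by apply: measurable_funM => //; exact: mh.
by under eq_fun do rewrite big_cons Pi.
Qed.

End measurable_bigop.

Section small_ball.
Context {R : realType} {d : measure_display} {T : measurableType d}
        (Pr : probability T R).

(** One integration step. [Y] will be the product over the rows not yet touched and [Z] the partial
    sum of the current row, both functions of earlier entries. *)
Lemma integral_gbump_peel (G : set (set T)) (X : {RV Pr >-> R}) (tau c v : R)
    (Y Z : T -> R) : G `<=` measurable -> 0 < v -> 0 < tau ->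
  indep_events Pr <<s G >> (rv_events X) ->
  (forall B, measurable B -> distribution Pr X B = normal_prob 0 tau B) ->
  measurable_fun setT (Y : g_sigma_algebraType G -> R) ->
  measurable_fun setT (Z : g_sigma_algebraType G -> R) ->
  (forall w, 0 <= Y w) ->
  (\int[Pr]_w (Y w * gbump v (Z w + c * X w))%:E =
   (Num.sqrt (v / (v + c ^+ 2 * tau ^+ 2)))%:E *
   \int[Pr]_w (Y w * gbump (v + c ^+ 2 * tau ^+ 2) (Z w))%:E)%E.
Proof.
move=> GT v0 tau0 indepX lawX mY mZ Y0.
pose X1 : {mfun T >-> g_sigma_algebraType G} :=
  mfun_Sub (mem_set (measurable_id_g_sigma GT)).
(* [normal_prob] is a measure on [measurableTypeR R], whose canonical
   measurable structure is not the one of [R]. *)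
have mX2 : @measurable_fun _ _ T (measurableTypeR R) setT X.
  by move=> mT B mB; exact: (measurable_funP X mT B mB).
pose X2 : {mfun T >-> measurableTypeR R} :=
  @mfun_Sub _ _ T (measurableTypeR R) X (mem_set mX2).
pose f (z : g_sigma_algebraType G * measurableTypeR R) :=
  (Y z.1 * gbump v (Z z.1 + c * z.2))%:E.
have mf : measurable_fun setT f.
  apply/measurable_EFinP; apply: measurable_funM.
    exact: measurableT_comp mY measurable_fst.
  apply: measurableT_comp; first exact: measurable_gbump.
  apply: measurable_funD; first exact: measurableT_comp mZ measurable_fst.
  by apply: measurable_funM => //; exact: measurable_snd.
rewrite [LHS](_ : _ = \int[Pr]_w f (X1 w, X2 w))%E //.
rewrite integral_indep //; first last.
- by move=> z; rewrite lee_fin mulr_ge0 ?gbump_ge0.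
- move=> A B mA mB; rewrite -(setTI (X2 @^-1` B)); apply: indepX => //.
  by exists B.
set v' := v + _; have v'0 : 0 < v' by rewrite ltr_pwDl // mulr_ge0 ?sqr_ge0.
transitivity (\int[Pr]_w ((Num.sqrt (v / v'))%:E * (Y w * gbump v' (Z w))%:E))%E.
  apply: eq_integral => w _; rewrite /f /=.
  under eq_integral do rewrite EFinM.
  rewrite ge0_integralZl //.
  - have -> : (\int[distribution Pr X2]_y (gbump v (Z w + c * y))%:E =
        \int[normal_prob 0 tau]_y (gbump v (Z w + c * y))%:E)%E.
      by apply: eq_measure_integral => B mB _; exact: lawX.
    by rewrite integral_gbump_normal // -!EFinM mulrCA.
  - apply/measurable_EFinP; apply: measurableT_comp; first exact: measurable_gbump.
    by apply: measurable_funD => //; exact: measurable_funM.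
  - by move=> y _; rewrite lee_fin gbump_ge0.
  - by rewrite lee_fin.
rewrite ge0_integralZl //.
- apply/measurable_EFinP; apply: measurable_funM.
    by apply: measurableT_comp mY (measurable_id_g_sigma GT).
  apply: measurableT_comp; first exact: measurable_gbump.
  exact: measurableT_comp mZ (measurable_id_g_sigma GT).
- by move=> w _; rewrite lee_fin mulr_ge0 ?gbump_ge0.
Qed.

Variables (s n : nat) (X : 'I_s -> 'I_n -> {RV Pr >-> R}).
Hypothesis gX : gaussian_matrix X.
Hypothesis s_gt0 : (0 < s)%N.

Lemma gaussian_matrix_indep :
  mutually_independent (fun p : 'I_s * 'I_n => X p.1 p.2).
Proof.
move=> B mB; have [_ /(_ (fun i j => B (i, j)))] := gX.
rewrite pair_bigA /= => XB; transitivity (Pr [set w | forall i j, B (i, j) (X i j w)]).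
  by congr (Pr _); apply/seteqP; split=> w /= h => [i j|[i j]]; [exact: h (i, j)|exact: h].
by rewrite XB //; apply: eq_bigr => -[i j].
Qed.

Variables (x : 'cV[R]_n) (v : R).
Hypothesis v_gt0 : 0 < v.

Let tau : R := Num.sqrt s%:R^-1.

Let tau_gt0 : 0 < tau.
Proof. by rewrite sqrtr_gt0 invr_gt0 ltr0n. Qed.

(* The Gaussian entries are integrated out one at a time, in decreasing
   lexicographic order; [before i j] are the entries preceding [(i, j)]. *)
Let before (i j : nat) : {pred 'I_s * 'I_n} :=
  [pred p : 'I_s * 'I_n | (p.1 < i)%N || ((p.1 : nat) == i) && (p.2 < j)%N].

Let past_entries (i j : nat) : set (set T) :=
  \bigcup_(p in [set` before i j]) rv_events (X p.1 p.2).

Let psum (i : 'I_s) (j : nat) (w : T) : R := \sum_(l < n | (l < j)%N) x l 0 * X i l w.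

(** The variance carried by the bump once the entries of the current row from column [j] on have
    been integrated out. *)
Let tail_var (j : nat) : R := v + \sum_(l < n | (j <= l)%N) x l 0 ^+ 2 * tau ^+ 2.

Let rows (i : nat) (w : T) : R := \prod_(k < s | (k < i)%N) gbump v (psum k n w).

Let past_entries_measurable i j : past_entries i j `<=` measurable.
Proof. by move=> A [p _]; exact: rv_events_measurable. Qed.

Let measurable_entry i j p : p \in before i j ->
  measurable_fun setT (X p.1 p.2 : g_sigma_algebraType (past_entries i j) -> R).
Proof. by move=> pij; apply: measurable_fun_rv_events => A XA; exists p. Qed.

Let measurable_psum i j (k : 'I_s) m :
  (forall l : 'I_n, (l < m)%N -> (k, l) \in before i j) ->
  measurable_fun setT (psum k m : g_sigma_algebraType (past_entries i j) -> R).
Proof.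
move=> km; apply: measurable_sum_cond => l lm.
by apply: measurable_funM => //; exact: (measurable_entry (p := (k, l)) (km _ lm)).
Qed.

Let measurable_rows (i j : nat) :
  measurable_fun setT (rows i : g_sigma_algebraType (past_entries i j) -> R).
Proof.
apply: measurable_prod_cond => k ki.
apply: measurableT_comp; first exact: measurable_gbump.
by apply: measurable_psum => l _; rewrite inE /= ki.
Qed.

Let rows_ge0 i w : 0 <= rows i w.
Proof. by apply: prodr_ge0 => k _; exact: gbump_ge0. Qed.

Let tail_var_gt0 j : 0 < tail_var j.
Proof. by rewrite ltr_pwDl // sumr_ge0 // => l _; rewrite mulr_ge0 ?sqr_ge0. Qed.

Let tail_varS (j : 'I_n) : tail_var j = tail_var j.+1 + x j 0 ^+ 2 * tau ^+ 2.
Proof.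
rewrite /tail_var -addrA; congr (_ + _); rewrite (bigD1 j) //= addrC; congr (_ + _).
by apply: eq_bigl => l; rewrite ltn_neqAle eq_sym andbC.
Qed.

Let psumS (i : 'I_s) (j : 'I_n) w : psum i j.+1 w = psum i j w + x j 0 * X i j w.
Proof.
rewrite /psum (bigD1 j) //= addrC; congr (_ + _).
by apply: eq_bigl => l; rewrite ltnS ltn_neqAle andbC.
Qed.

Let row_peel (i : 'I_s) (j : 'I_n) :
  (\int[Pr]_w (rows i w * gbump (tail_var j.+1) (psum i j.+1 w))%:E =
   (Num.sqrt (tail_var j.+1 / tail_var j))%:E *
   \int[Pr]_w (rows i w * gbump (tail_var j) (psum i j w))%:E)%E.
Proof.
under eq_integral do rewrite psumS.
have ij : (i, j) \notin before i j by rewrite inE /= ltnn eqxx ltnn.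
have indepX := mutually_independent_indep gaussian_matrix_indep ij.
have mpsum : measurable_fun setT
    (psum i j : g_sigma_algebraType (past_entries i j) -> R).
  by apply: measurable_psum => l lj; rewrite inE /= eqxx lj orbT.
by rewrite (integral_gbump_peel (x j 0) (@past_entries_measurable i j)
  (tail_var_gt0 _) tau_gt0 indepX (gX.1 i j) (@measurable_rows i j) mpsum
  (@rows_ge0 i)) -tail_varS.
Qed.

(** The factors of the successive columns telescope; at [j = 0] the partial sum is empty and the
    bump equals 1. *)
Let row_peel_all (i : 'I_s) (j : nat) : (j <= n)%N ->
  (\int[Pr]_w (rows i w * gbump (tail_var j) (psum i j w))%:E =
   (Num.sqrt (tail_var j / tail_var 0))%:E * \int[Pr]_w (rows i w)%:E)%E.
Proof.
elim: j => [_|j IHj jn].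
  rewrite divff ?gt_eqF // sqrtr1 mul1e; apply: eq_integral => w _.
  rewrite /psum big_pred0 // /gbump expr0n /= mul0r oppr0 expR0 mulr1 //.
rewrite (row_peel i (Ordinal jn)) /= IHj ?(ltnW jn) // muleA -EFinM -sqrtrM.
  by rewrite mulrA divfK // gt_eqF.
by rewrite ltW // divr_gt0.
Qed.

(** The Laplace transform of [|P x|^2]: the coordinates of [P x] are independent centred Gaussians
    of variance [|x|^2 / s], and each row contributes one square root. *)
Lemma integral_gbump_rows :
  (\int[Pr]_w (\prod_(k < s) gbump v ((rv_mx X w *m x) k 0))%:E =
   (Num.sqrt (v / (v + enorm x ^+ 2 / s%:R)) ^+ s)%:E)%E.
Proof.
have tailn : tail_var n = v.
  by rewrite /tail_var big_pred0 ?addr0 // => l; rewrite leqNgt ltn_ord.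
have tail0 : tail_var 0 = v + enorm x ^+ 2 / s%:R.
  rewrite /tail_var sqr_enorm /edot -mulr_suml sqr_sqrtr ?invr_ge0 ?ler0n //.
have rowsE i : (i <= s)%N -> (\int[Pr]_w (rows i w)%:E =
    (Num.sqrt (v / tail_var 0) ^+ i)%:E)%E.
  elim: i => [_|i IHi si].
    under eq_integral do rewrite /rows big_pred0 //.
    by rewrite integral_cst // mul1e; exact: probability_setT.
  rewrite exprS EFinM -IHi ?(ltnW si) // -tailn -(row_peel_all (Ordinal si)) //.
  apply: eq_integral => w _; rewrite /rows (bigD1 (Ordinal si)) //= mulrC tailn.
  congr (_ * _)%:E; apply: eq_bigl => k.
  by rewrite ltnS ltn_neqAle andbC.
rewrite -tail0 -(rowsE s (leqnn s)); apply: eq_integral => w _; congr _%:E.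
rewrite /rows; apply: eq_big => [k|k _]; first by rewrite ltn_ord.
congr gbump; rewrite mxE /psum; apply: eq_big => [l|l _]; first by rewrite ltn_ord.
by rewrite mxE mulrC.
Qed.

End small_ball.

Section measurable_vectors.
Context {R : realType} {d : measure_display} {T : measurableType d}.

Lemma measurable_set_lt (f g : T -> R) : measurable_fun setT f ->
  measurable_fun setT g -> measurable [set w | f w < g w].
Proof.
move=> mf mg; have := measurable_fun_ltr mf mg measurableT (Y := [set true]) I.
by rewrite setTI.
Qed.

Lemma measurable_set_le (f g : T -> R) : measurable_fun setT f ->
  measurable_fun setT g -> measurable [set w | f w <= g w].
Proof.
move=> mf mg; have := measurable_fun_ler mf mg measurableT (Y := [set true]) I.
by rewrite setTI.
Qed.

Lemma measurable_enorm n (y : T -> 'cV[R]_n) :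
  (forall i, measurable_fun setT (fun w => y w i 0)) ->
  measurable_fun setT (fun w => enorm (y w)).
Proof.
move=> my; apply: (@measurableT_comp _ _ _ _ _ _ (@Num.sqrt R)).
  by apply: continuous_measurable_fun; exact: sqrt_continuous.
by apply: measurable_sum => i; apply: measurable_funX.
Qed.

Lemma measurable_mulmx m n (A : T -> 'M[R]_(m, n)) (y : T -> 'cV[R]_n) i :
  (forall i j, measurable_fun setT (fun w => A w i j)) ->
  (forall j, measurable_fun setT (fun w => y w j 0)) ->
  measurable_fun setT (fun w => (A w *m y w) i 0).
Proof.
move=> mA my; under eq_fun do rewrite mxE.
by apply: measurable_sum => j; apply: measurable_funM.
Qed.

End measurable_vectors.

Section small_ball_probability.
Context {R : realType} {d : measure_display} {T : measurableType d}
        (Pr : probability T R).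
Variables (s n : nat) (X : 'I_s -> 'I_n -> {RV Pr >-> R}).
Hypothesis gX : gaussian_matrix X.
Hypothesis s_gt0 : (0 < s)%N.

(** Chosen so that [a ^+ s * expR (s / 2) = expR (- (2 * s))], the product that comes out of the
    Markov argument below. *)
Let a : R := expR (- (5 / 2)).

Let measurable_small_ball (x : 'cV[R]_n) (r : R) :
  measurable [set w | enorm (rv_mx X w *m x) < r].
Proof.
apply: measurable_set_lt => //; apply: measurable_enorm => i.
apply: measurable_mulmx => [k j|j] //.
by under eq_fun do rewrite mxE; exact: measurable_funP.
Qed.

(** Markov's inequality for [exp (- |P x|^2 / (2 v))]. With [v = a^2 |x|^2 / s] this variable is at
    least [exp (- s / 2)] on the event, and its mean is [(a^2 / (1 + a^2))^(s / 2) <= a^s]. *)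
Lemma gaussian_small_ball (x : 'cV[R]_n) :
  (Pr [set w | (enorm (rv_mx X w *m x) < a * enorm x)%R] <= (expR (- (2 * s%:R)))%:E)%E.
Proof.
have [/eqP x0|x0] := boolP (enorm x == 0).
  rewrite (_ : [set w | _] = set0) ?measure0 ?lee_fin ?expR_ge0 //.
  by apply/seteqP; split=> w //=; rewrite x0 mulr0 ltNge enorm_ge0.
have x_gt0 : 0 < enorm x by rewrite lt_def x0 enorm_ge0.
have a_gt0 : 0 < a by exact: expR_gt0.
have s0 : 0 < s%:R :> R by rewrite ltr0n.
set A := [set w | _].
have mPx i : measurable_fun setT (fun w => (rv_mx X w *m x) i 0).
  apply: measurable_mulmx => [k j|j] //.
  by under eq_fun do rewrite mxE; exact: measurable_funP.
have mA : measurable A by exact: measurable_small_ball.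
pose v := a ^+ 2 * enorm x ^+ 2 / s%:R.
have v_gt0 : 0 < v by rewrite divr_gt0 // mulr_gt0 // exprn_gt0.
have prodE w : \prod_(k < s) gbump v ((rv_mx X w *m x) k 0) =
    expR (- (enorm (rv_mx X w *m x) ^+ 2 / (2 * v))).
  rewrite -expR_sum sumrN sqr_enorm /edot -mulr_suml.
  by congr (expR (- (_ / _))); apply: eq_bigr => k _; rewrite expr2.
have : (\int[Pr]_w ((expR (- (s%:R / 2)))%:E * (\1_A w)%:E) <=
    \int[Pr]_w (\prod_(k < s) gbump v ((rv_mx X w *m x) k 0))%:E)%E.
  apply: ge0_le_integral => //.
  - apply/measurable_EFinP; apply: measurable_funM => //.
  - apply/measurable_EFinP; apply: measurable_prod => k _.
    by apply: measurableT_comp => //; exact: measurable_gbump.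
  - move=> w _; rewrite -EFinM lee_fin prodE indicE.
    have [/set_mem Aw|_] := boolP (w \in A); last by rewrite mulr0 expR_ge0.
    rewrite mulr1 ler_expR lerN2 ler_pdivrMr; last exact: mulr_gt0.
    have -> : s%:R / 2 * (2 * v) = (a * enorm x) ^+ 2.
      by rewrite /v; field; rewrite gt_eqF.
    by rewrite ler_pXn2r ?nnegrE ?enorm_ge0 ?mulr_ge0 ?enorm_ge0 ?(ltW a_gt0) ?(ltW Aw).
rewrite integral_gbump_rows // ge0_integralZl //; last exact/measurable_EFinP.
rewrite integral_indic // setIT => h.
rewrite -(@lee_pmul2l _ (expR (- (s%:R / 2)))%:E) ?lte_fin ?expR_gt0 //.
apply: (le_trans h); rewrite -EFinM lee_fin -expRD.
apply: (@le_trans _ _ (a ^+ s)).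
  apply: lerXn2r; rewrite ?nnegrE ?sqrtr_ge0 ?(ltW a_gt0) //.
  rewrite -[leRHS](gtr0_norm a_gt0) -sqrtr_sqr ler_wsqrtr //.
  rewrite ler_pdivrMr; last by rewrite addr_gt0 // divr_gt0 // exprn_gt0.
  have -> : enorm x ^+ 2 / s%:R = v / a ^+ 2 by rewrite /v; field; rewrite !gt_eqF.
  rewrite mulrDr [X in _ + X]mulrC divfK ?expf_neq0 ?gt_eqF //.
  by rewrite lerDr mulr_ge0 ?sqr_ge0 ?(ltW v_gt0).
by rewrite /a -expRM_natl ler_expR; lra.
Qed.

(** The bound for a fixed vector is uniform in that vector, so it survives averaging over a random
    vector independent of the sketch. *)
Lemma gaussian_small_ball_indep (G1 G2 : set (set T)) (x : T -> 'cV[R]_n) :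
  G1 `<=` measurable -> G2 `<=` measurable ->
  indep_events Pr <<s G1 >> <<s G2 >> ->
  (forall i j, rv_events (X i j) `<=` G2) ->
  (forall j, measurable_fun setT ((fun w => x w j 0) : g_sigma_algebraType G1 -> R)) ->
  (Pr [set w | (enorm (rv_mx X w *m x w) < a * enorm (x w))%R] <=
   (expR (- (2 * s%:R)))%:E)%E.
Proof.
move=> G1T G2T indep12 XG2 mx.
pose X1 : {mfun T >-> g_sigma_algebraType G1} :=
  mfun_Sub (mem_set (measurable_id_g_sigma G1T)).
pose X2 : {mfun T >-> g_sigma_algebraType G2} :=
  mfun_Sub (mem_set (measurable_id_g_sigma G2T)).
pose B : set (g_sigma_algebraType G1 * g_sigma_algebraType G2) :=
  [set z | enorm (rv_mx X z.2 *m x z.1) < a * enorm (x z.1)].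
have mx1 j : measurable_fun setT
    (fun z : g_sigma_algebraType G1 * g_sigma_algebraType G2 => x z.1 j 0).
  exact: measurableT_comp (mx j) measurable_fst.
have mB : measurable B.
  apply: measurable_set_lt; last first.
    by apply: measurable_funM => //; exact: measurable_enorm.
  apply: measurable_enorm => i; apply: measurable_mulmx => [k j|j] //.
  under eq_fun do rewrite mxE.
  exact: measurableT_comp (measurable_fun_rv_events (@XG2 k j)) measurable_snd.
set A := [set w | _].
have mA : measurable A.
  have mX : measurable_fun setT (fun w => (X1 w, X2 w)).
    by apply/measurable_fun_pairP; split; exact: measurable_funP.
  by have := mX measurableT B mB; rewrite setTI.
have -> : Pr A = (\int[Pr]_w (\1_B (X1 w, X2 w))%:E)%E.
  transitivity (\int[Pr]_w (\1_A w)%:E)%E; first by rewrite integral_indic // setIT.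
  by apply: eq_integral => w _; rewrite !indicE.
rewrite (integral_indep (f := EFin \o \1_B)); first last.
- by move=> z; rewrite /= lee_fin indicE ler0n.
- exact/measurable_EFinP.
- by move=> C D mC mD; exact: indep12.
apply: (@le_trans _ _ (\int[Pr]_w (cst (expR (- (2 * s%:R)))%:E w))%E).
  apply: ge0_le_integral => //.
  - by move=> w _; apply: integral_ge0 => z _; rewrite /= lee_fin indicE ler0n.
  - have mF : measurable_fun setT (fubini_F (distribution Pr X2) (EFin \o \1_B)).
      apply: measurable_fun_fubini_tonelli_F; first exact/measurable_EFinP.
      by move=> z; rewrite /= lee_fin indicE ler0n.
    exact: measurableT_comp mF (measurable_id_g_sigma G1T).
  - move=> w _; rewrite ge0_integral_distribution.
    + apply: le_trans (gaussian_small_ball (x w)).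
      set C := [set w2 | _]; rewrite -[X in (_ <= Pr X)%E]setIT -integral_indic //.
      exact: measurable_small_ball.
    + apply: (measurable_fun_pair2 (f := EFin \o \1_B)).
      exact/measurable_EFinP.
    + by move=> z; rewrite /= lee_fin indicE ler0n.
have /= -> := integral_cst Pr measurableT (expR (- (2 * s%:R)))%:E.
by rewrite probability_setT mule1.
Qed.

End small_ball_probability.

(** * Measurability *)

Section measurability.
Context {R : realType}.

Lemma measurable_inv : measurable_fun setT (@GRing.inv R).
Proof.
have m0 : measurable [set 0 : R] by exact: measurable_set1.
rewrite -(setUv [set 0 : R]); apply/measurable_funU => //; first exact: measurableC.
split; first exact: measurable_fun_set1.
apply: open_continuous_measurable_fun.
  by apply: closed_openC; exact: closed_eq.
by move=> x; rewrite inE /= => /eqP x0; exact: inv_continuous.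
Qed.

(** The grid of mesh [1 / (N + 1)], indexed by a countable type: it reduces quantifiers and limits
    over all real vectors to countable operations. *)
Definition disc {n} (N : nat) (m : 'cV[int]_n) : 'cV[R]_n :=
  \col_i ((m i 0)%:~R / N.+1%:R).

Definition cfloor {n} (N : nat) (y : 'cV[R]_n) : 'cV[int]_n :=
  \col_i Num.floor (y i 0 * N.+1%:R).

Lemma cvg_disc n (y : 'cV[R]_n) : disc N (cfloor N y) @[N --> \oo] --> y.
Proof.
apply/cvgrPdist_le => e e0; near=> N.
rewrite [leLHS]/Num.Def.normr /= mx_normrE (bigmax_le _ (ltW e0)) // => -[i j] _ /=.
rewrite !mxE (ord1 j); set z := y i 0; set k := N.+1%:R : R.
have k0 : 0 < k by rewrite ltr0n.
have /andP[h1 h2] := floor_itv (z * k).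
have -> : z - (Num.floor (z * k))%:~R / k = (z * k - (Num.floor (z * k))%:~R) / k.
  by field; rewrite gt_eqF.
rewrite ger0_norm; last by rewrite divr_ge0 ?subr_ge0 // ltW.
rewrite ler_pdivrMr //.
apply: (@le_trans _ _ 1); first by rewrite lerBlDl ltW // (lt_le_trans h2) // intrD.
rewrite -ler_pdivrMr // mul1r /k ltW //.
by near: N; exact: (near_infty_natSinv_lt (PosNum e0)).
Unshelve. all: by end_near. Qed.

(** [phi] after rounding takes countably many values, each on a union of cells cut out by
    coordinatewise inequalities; continuity recovers [phi (Z w)] as the pointwise limit. *)
Lemma measurable_continuous_comp {d} {T : measurableType d} n (phi : 'cV[R]_n -> R)
    (Z : T -> 'cV[R]_n) : continuous phi ->
  (forall i, measurable_fun setT (fun w => Z w i 0)) ->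
  measurable_fun setT (fun w => phi (Z w)).
Proof.
move=> cphi mZ.
apply: (@measurable_fun_cvg _ _ _ setT (fun N w => phi (disc N (cfloor N (Z w))))); last first.
  move=> w _; apply: (cvg_comp (fun N => disc N (cfloor N (Z w))) phi).
    exact: cvg_disc.
  exact: cphi.
move=> N _ B mB; rewrite setTI.
pose cell (m : 'cV[int]_n) := [set w | cfloor N (Z w) = m].
have mcell m : measurable (cell m).
  rewrite (_ : cell m = \bigcap_(i in [set: 'I_n])
      ([set w | (m i 0)%:~R <= Z w i 0 * N.+1%:R] `&`
       [set w | Z w i 0 * N.+1%:R < (m i 0 + 1)%:~R])).
    apply: fin_bigcap_measurable => // i _; apply: measurableI.
      by apply: measurable_set_le => //; exact: measurable_funM.
    by apply: measurable_set_lt => //; exact: measurable_funM.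
  apply/seteqP; split=> w /=.
    by move=> <- i _; rewrite mxE; have /andP[] := floor_itv (Z w i 0 * N.+1%:R).
  move=> h; apply/matrixP => i j; rewrite (ord1 j) mxE; apply: floor_def.
  by have [-> ->] := h i I.
rewrite (_ : _ @^-1` B = \bigcup_m (if disc N m \in phi @^-1` B then cell m else set0)).
  by apply: countable_bigcupT_measurable => // m; case: ifP.
apply/seteqP; split=> w /=.
  by move=> Bw; exists (cfloor N (Z w)) => //; rewrite ifT // inE.
by move=> [m _]; case: ifPn => //; rewrite inE /= => Bm ->.
Qed.

Lemma cvg_enorm_mulmx_disc m n (A : 'M[R]_(m, n)) (y : 'cV[R]_n) :
  enorm (A *m disc N (cfloor N y)) @[N --> \oo] --> enorm (A *m y).
Proof.
apply: (cvg_comp _ (@Num.sqrt R)); last exact: sqrt_continuous.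
apply: cvg_big => [|i _]; first exact: add_continuous.
apply: (@cvg_comp _ _ _ (fun N => (A *m disc N (cfloor N y)) i 0)
  (fun z => z ^+ 2)); last exact: exprn_continuous.
have -> : (fun N => (A *m disc N (cfloor N y)) i 0) =
    (fun N => \sum_j A i j * disc N (cfloor N y) j 0).
  by apply/funext => N; rewrite mxE.
rewrite mxE; apply: cvg_big => [|j _]; first exact: add_continuous.
apply: cvgM; first exact: cvg_cst.
apply: (cvg_comp _ (fun M : 'cV[R]_n => M j 0)); first exact: cvg_disc.
exact: coord_continuous.
Qed.

(** The two inequalities are closed conditions on [y], so it suffices to impose them on the grid
    points. *)
Lemma measurable_sing_val d (T : measurableType d) m n (A : T -> 'M[R]_(m, n)) (lo hi : R) :
  (forall i j, measurable_fun setT (fun w => A w i j)) ->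
  measurable [set w | forall y : 'cV[R]_n,
    lo * enorm y <= enorm (A w *m y) <= hi * enorm y].
Proof.
move=> mA.
have mAy (y : 'cV[R]_n) : measurable_fun setT (fun w => enorm (A w *m y)).
  by apply: measurable_enorm => i; exact: measurable_mulmx.
rewrite [X in measurable X](_ : _ = \bigcap_N \bigcap_(p in [set: 'cV[int]_n])
    ([set w | lo * enorm (disc N p) <= enorm (A w *m disc N p)] `&`
     [set w | enorm (A w *m disc N p) <= hi * enorm (disc N p)])).
  apply: bigcap_measurableType => N _; rewrite -[X in measurable X]setCK setC_bigcap.
  apply: measurableC; apply: countable_bigcupT_measurable => // p.
  by apply: measurableC; apply: measurableI; exact: measurable_set_le.
apply/seteqP; split=> w /=.
  by move=> h N _ p _; split; have /andP[] := h (disc N p).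
move=> h y.
have cy : enorm (disc N (cfloor N y)) @[N --> \oo] --> enorm y.
  have := @cvg_enorm_mulmx_disc _ _ 1%:M y; rewrite mul1mx.
  by under eq_cvg do rewrite mul1mx.
have cAy := @cvg_enorm_mulmx_disc _ _ (A w) y.
have hN N := h N I (cfloor N y) I.
apply/andP; split.
- apply: (ler_cvg_to (cvgM (cvg_cst lo) cy) cAy).
  by apply: nearW => N; have [] := hN N.
- apply: (ler_cvg_to cAy (cvgM (cvg_cst hi) cy)).
  by apply: nearW => N; have [] := hN N.
Qed.

End measurability.

Section run_measurability.
Context {R : realType} {d : measure_display} {T : measurableType d}
        {Pr : probability T R} {s n : nat}.
Variables (x0 : 'cV[R]_n) (Delta : R).
Variables (P : nat -> 'I_s -> 'I_n -> {RV Pr >-> R})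
          (v : nat -> 'I_s -> {RV Pr >-> R})
          (t : nat -> {RV Pr >-> R}).

(** The generators of [past], named separately because [g_sigma_algebraType] is built from a
    generating family. *)
Definition past_generator (k : nat) : set (set T) := \bigcup_(j in `I_k)
  ((\bigcup_i \bigcup_l rv_events (P j i l)) `|`
   (\bigcup_i rv_events (v j i)) `|` rv_events (t j)).

Lemma past_generator_measurable k : past_generator k `<=` measurable.
Proof.
move=> A [j _] [[[i _ [l _]]|[i _]]|]; exact: rv_events_measurable.
Qed.

Lemma measurable_dir k j i : (j < k)%N ->
  measurable_fun setT ((fun w => dir P v t j w i 0) :
    g_sigma_algebraType (past_generator k) -> R).
Proof.
move=> jk.
have mP a b : measurable_fun setT (P j a b : g_sigma_algebraType (past_generator k) -> R).
  apply: measurable_fun_rv_events => A PA; exists j => //.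
  by left; left; exists a => //; exists b.
have mv a : measurable_fun setT (v j a : g_sigma_algebraType (past_generator k) -> R).
  by apply: measurable_fun_rv_events => A PA; exists j => //; left; right; exists a.
have mt : measurable_fun setT (t j : g_sigma_algebraType (past_generator k) -> R).
  by apply: measurable_fun_rv_events => A PA; exists j => //; right.
have mPv : measurable_fun setT ((fun w => ((rv_mx (P j) w)^T *m rv_col (v j) w) i 0) :
    g_sigma_algebraType (past_generator k) -> R).
  apply: measurable_mulmx => [a b|b].
    by under eq_fun do rewrite mxE mxE; exact: mP.
  by under eq_fun do rewrite mxE; exact: mv.
have -> : (fun w => dir P v t j w i 0) = (fun w => if t j w == 0
    then ((rv_mx (P j) w)^T *m rv_col (v j) w) i 0
    else (t j w)^-1 * ((rv_mx (P j) w)^T *m rv_col (v j) w) i 0).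
  by apply/funext => w; rewrite /dir /direction; case: ifP => // _; rewrite mxE.
apply: measurable_fun_ifT => //.
  by apply: measurable_fun_eqr.
by apply: measurable_funM => //; apply: measurableT_comp mt; exact: measurable_inv.
Qed.

Lemma measurable_iterate k m i : (m <= k)%N ->
  measurable_fun setT ((fun w => iterate x0 Delta P v t m w i 0) :
    g_sigma_algebraType (past_generator k) -> R).
Proof.
elim: m i => [|m IHm] i mk; first exact: measurable_cst.
have mdir l : measurable_fun setT ((fun w => dir P v t m w l 0) :
    g_sigma_algebraType (past_generator k) -> R) by exact: measurable_dir.
have mnorm : measurable_fun setT ((fun w => enorm (dir P v t m w)) :
    g_sigma_algebraType (past_generator k) -> R) by exact: measurable_enorm.
have mit := IHm i (ltnW mk).
have -> : (fun w => iterate x0 Delta P v t m.+1 w i 0) =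
    (fun w => if Delta < enorm (dir P v t m w)
      then iterate x0 Delta P v t m w i 0 +
           Delta * (enorm (dir P v t m w))^-1 * dir P v t m w i 0
      else iterate x0 Delta P v t m w i 0).
  by apply/funext => w /=; case: ifP => // _; rewrite !mxE.
apply: measurable_fun_ifT => //; first exact: measurable_fun_ltr.
apply: measurable_funD => //; apply: measurable_funM => //.
by apply: measurable_funM => //; apply: measurableT_comp mnorm; exact: measurable_inv.
Qed.

Lemma measurable_terminates_at k : measurable [set w | terminates_at Delta P v t k w].
Proof.
have mnorm j : measurable_fun setT (fun w : T => enorm (dir P v t j w)).
  apply: measurable_enorm => i.
  have mdir := measurable_dir i (ltnSn j).
  exact: measurableT_comp mdir (measurable_id_g_sigma (@past_generator_measurable j.+1)).
rewrite (_ : [set w | _] = (\bigcap_(j in `I_k) [set w | Delta < enorm (dir P v t j w)]) `&`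
  [set w | enorm (dir P v t k w) <= Delta]) //.
apply: measurableI; last exact: measurable_set_le.
by apply: bigcap_measurableType => j _; exact: measurable_set_lt.
Qed.

End run_measurability.

(** * Descent and termination *)

Section descent.
Context {R : realType} {d : measure_display} {T : measurableType d}
        {Pr : probability T R} {s n : nat}.
Variables (f : 'cV[R]_n -> R) (x0 : 'cV[R]_n) (M e sigma delta : R).
Variables (P : nat -> 'I_s -> 'I_n -> {RV Pr >-> R})
          (v : nat -> 'I_s -> {RV Pr >-> R})
          (t : nat -> {RV Pr >-> R}).
Let Delta := e / M.
Let x := iterate x0 Delta P v t.

Hypothesis f_C2 : C2 f.
Hypothesis hessM : forall y z, opnorm (hess f y - hess f z) <= M * enorm (y - z).
Hypotheses (M_gt0 : 0 < M) (e_gt0 : 0 < e) (sigma_gt0 : 0 < sigma).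
Hypothesis deltaE : delta = sigma ^+ 2 * e.
Hypothesis run : rshtr_run x0 Delta P v t f delta.

Let delta_gt0 : 0 < delta.
Proof. by rewrite deltaE mulr_gt0 // exprn_gt0. Qed.

Let Delta_gt0 : 0 < Delta. Proof. exact: divr_gt0. Qed.

(** Put [z = e^3 / (3 M^2)]. The model decreases by [e * Delta^2 / 2 = 3 z / 2] and the Taylor error
    is [M * Delta^3 / 6 = z / 2], which leaves [z]. *)
Lemma step_decrease k w :
  (forall y, enorm ((rv_mx (P k) w)^T *m y) <= sigma * enorm y) ->
  reached Delta P v t k w -> Delta < enorm (dir P v t k w) ->
  f (x k.+1 w) <= f (x k w) - e ^+ 3 / (3 * M ^+ 2).
Proof.
move=> P_le rk d_gt; have sol := run_sol run rk.
have [] := model_decrease delta_gt0 Delta_gt0 P_le sol deltaE e_gt0 d_gt.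
set u := (_ / _) *: _ => uD model.
rewrite /x /= d_gt (le_trans (taylor_hess_lipschitz _ _ f_C2 hessM)) // -/u uD.
have -> : M / 6 * Delta ^+ 3 = e ^+ 3 / (3 * M ^+ 2) / 2.
  by rewrite /Delta; field; rewrite gt_eqF.
have : e * Delta ^+ 2 / 2 = e ^+ 3 / (3 * M ^+ 2) * (3 / 2).
  by rewrite /Delta; field; rewrite gt_eqF.
move: model; rewrite -/(iterate x0 Delta P v t k w).
move: (edot _ _) (quad _ _) (f _) (e ^+ 3 / _) (e * _) => p q fx z E.
lra.
Qed.

(** Without termination, [N] successive decreases would push [f] below its infimum. *)
Lemma exists_termination N w : has_lbound (range f) ->
  (forall k y, (k < N)%N ->
     enorm ((rv_mx (P k) w)^T *m y) <= sigma * enorm y) ->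
  3 * M ^+ 2 * (f x0 - inf (range f)) < N%:R * e ^+ 3 ->
  exists2 k, (k < N)%N & terminates_at Delta P v t k w.
Proof.
move=> f_lb P_le N_gt; apply: contrapT => no_term.
have reachedN k : (k <= N)%N -> reached Delta P v t k w.
  elim: k => [_ []//|k IHk kN j].
  rewrite ltnS leq_eqVlt => /predU1P[->|jk]; last exact: IHk (ltnW kN) _ jk.
  rewrite ltNge; apply/negP => d_le; apply: no_term.
  by exists k => //; split => //; exact: IHk (ltnW kN).
have f_le k : (k <= N)%N -> f (x k w) <= f x0 - k%:R * (e ^+ 3 / (3 * M ^+ 2)).
  elim: k => [_|k IHk kN]; first by rewrite mul0r subr0.
  have h1 := IHk (ltnW kN).
  have h2 := step_decrease (fun y => P_le k y kN) (reachedN k (ltnW kN))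
    (reachedN k.+1 kN k (ltnSn k)).
  rewrite -natr1 mulrDl mul1r; move: h1 h2.
  move: (f (x k w)) (f (x k.+1 w)) (f x0) (e ^+ 3 / _) (k%:R) => a b c z m.
  lra.
have := f_le N (leqnn N).
have : inf (range f) <= f (x N w) by apply: ge_inf => //; exists (x N w).
move: N_gt; move: (f (x N w)) (f x0) (inf _) => a b c; move: (N%:R : R) => m h1 h2 h3.
have : m * (e ^+ 3 / (3 * M ^+ 2)) <= b - c by lra.
rewrite mulrA ler_pdivrMr; last by rewrite mulr_gt0 // exprn_gt0.
lra.
Qed.

Lemma termination_grad_le sigma1 L k w : 1 <= sigma1 -> Delta < 1 -> 0 <= L ->
  (forall y z, enorm (grad f y - grad f z) <= L * enorm (y - z)) ->
  (forall y, sigma1 * enorm y <= enorm ((rv_mx (P k) w)^T *m y) <= sigma * enorm y) ->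
  terminates_at Delta P v t k w ->
  (1 - Delta ^+ 2) * enorm (rv_mx (P k) w *m grad f (x k w)) <=
    (sigma * L + delta / sigma1) * Delta.
Proof.
move=> sigma1_ge1 Delta_lt1 L0 gradL P_sv [rk d_le].
have [_ dg _] := f_C2.
apply: (sketched_grad_le delta_gt0 Delta_gt0 sigma_gt0 _ (run_sol run rk)) => //.
- by move=> y; have /andP[] := P_sv y.
- by move=> y; have /andP[] := P_sv y.
- exact: hess_lipschitz_grad.
Qed.

End descent.

(** * Numerical constants and the union bound *)

Section constants.
Context {R : realType}.

Lemma powR_neg32 (eps : R) : 0 < eps -> eps `^ (- (3 / 2)) = (Num.sqrt eps ^+ 3)^-1.
Proof.
move=> eps0; rewrite powRN; congr (_^-1).
by rewrite mulrC powRrM powR12_sqrt ?ltW // powR_mulrn // sqrtr_ge0.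
Qed.

(** The hypothesis, raised to the power [tau / 2], reads [1 <= c^(tau / 2) * q^(tau / 2) * sqrt
    eps]; multiplying by [sqrt eps] gives the claim. *)
Lemma sqrt_le_powR (q c tau eps : R) : 0 < q -> 0 < c -> 0 < tau -> 0 < eps ->
  1 <= c * q * eps `^ tau^-1 ->
  Num.sqrt eps <= c `^ (tau / 2) * q `^ (tau / 2) * eps.
Proof.
move=> q0 c0 tau0 eps0 h.
have : 1 <= (c * q * eps `^ tau^-1) `^ (tau / 2).
  by rewrite -[leLHS](powRr0 (c * q * eps `^ tau^-1)) ler_powR // divr_ge0 // ltW.
have -> : (c * q * eps `^ tau^-1) `^ (tau / 2) =
    c `^ (tau / 2) * q `^ (tau / 2) * Num.sqrt eps.
  have c_ge0 := ltW c0; have q_ge0 := ltW q0; have eps_ge0 := ltW eps0.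
  rewrite powRM ?mulr_ge0 ?powR_ge0 // powRM // -powRrM -powR12_sqrt //.
  by congr (_ * _ `^ _); field; rewrite gt_eqF.
move=> {}h.
have e0 : 0 < Num.sqrt eps by rewrite sqrtr_gt0.
rewrite -[X in _ <= _ * X](sqr_sqrtr (ltW eps0)) expr2 mulrA.
by rewrite ler_peMl // ltW.
Qed.

(** The lower bound on [r] gives [r + Cs <= 3 r / 2] and [r - Cs >= r / 2], so the quotient is at
    most [9 / 2 * r * e]. Dividing by [7 / 8] produces [12 / 7] and [36 / 7], rounded up to 2 and
    6. *)
Lemma sketched_grad_bound (r Cs L M e G : R) : 2 * `|Cs| + 2 <= r -> 0 <= L ->
  0 < M -> 0 < e -> (e / M) ^+ 2 <= 8^-1 -> e / M <= 1 -> 0 <= G ->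
  (1 - (e / M) ^+ 2) * G <=
    ((r + Cs) * L + (r + Cs) ^+ 2 * e / (r - Cs)) * (e / M) ->
  G <= r * e * (2 * L / M + 6).
Proof.
move=> r_ge L0 M0 e0 D2 D1 G0 G_le.
have Cs_le := ler_norm Cs; have Cs_ge := ler_norm (- Cs); rewrite normrN in Cs_ge.
have r0 : 0 < r by clear -r_ge Cs_le Cs_ge; lra.
have sigma1_gt0 : 0 < r - Cs by clear -r_ge Cs_le Cs_ge; lra.
have sigma_ge0 : 0 <= r + Cs by clear -r_ge Cs_le Cs_ge; lra.
have sigma_le : r + Cs <= 3 / 2 * r by clear -r_ge Cs_le Cs_ge; lra.
have sigma1_ge : r <= 2 * (r - Cs) by clear -r_ge Cs_le Cs_ge; lra.
have delta_le : (r + Cs) ^+ 2 * e / (r - Cs) <= 9 / 2 * r * e.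
  rewrite ler_pdivrMr // [leRHS]mulrAC ler_pM2r //.
  have : (r + Cs) ^+ 2 <= (3 / 2 * r) ^+ 2.
    by rewrite ler_pXn2r ?nnegrE // mulr_ge0 ?(ltW r0).
  by clear -r0 sigma1_ge; nra.
have D0 : 0 <= e / M by rewrite divr_ge0 ?ltW.
have {}G_le : 7 / 8 * G <= (3 / 2 * r * L + 9 / 2 * r * e) * (e / M).
  apply: (@le_trans _ _ ((1 - (e / M) ^+ 2) * G)).
    by rewrite ler_wpM2r //; clear -D2; lra.
  by apply: (le_trans G_le); rewrite ler_wpM2r // lerD // ler_wpM2r.
have h1 : 9 / 2 * r * e * (e / M) <= 9 / 2 * r * e.
  by rewrite ler_piMr // !mulr_ge0 ?(ltW e0) ?(ltW r0).
have h2 : 0 <= r * e * (L / M) by rewrite !mulr_ge0 ?invr_ge0 ?(ltW e0) ?(ltW r0) ?(ltW M0).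
have h3 : r * L * (e / M) = r * e * (L / M) by ring.
have h4 : 0 <= r * e by rewrite mulr_ge0 ?ltW.
rewrite -[2 * L / M]mulrA; move: (L / M) (e / M) h1 h2 h3 h4 G_le => lm em.
by clear; lra.
Qed.

End constants.

Section union_bound.
Context {R : realType} {d : measure_display} {T : measurableType d}
        (Pr : probability T R).
Local Open Scope ereal_scope.

Lemma union_bound (A : nat -> set T) (p : R) N :
  (forall k, measurable (A k)) -> (forall k, Pr (A k) <= p%:E) ->
  Pr (\bigcup_(k in `I_N) A k) <= (p *+ N)%:E.
Proof.
move=> mA Ap; elim: N => [|N IHN]; first by rewrite II0 bigcup_set0 measure0.
rewrite IIS bigcup_setU bigcup_set1 mulrSr EFinD.
apply: le_trans (measureU2 Pr _ (mA N)) _.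
  by apply: bigcup_measurable => k _.
by apply: leeD => //; exact: Ap.
Qed.

Lemma prob_setC_le (A : set T) (p : R) : measurable A ->
  (1 - p)%:E <= Pr A -> Pr (~` A) <= p%:E.
Proof.
move=> mA; rewrite probability_setC // -(fineK (fin_num_measure Pr A mA)).
by rewrite -EFinB !lee_fin => h; lra.
Qed.

Lemma prob_setC_ge (A : set T) (p : R) : measurable A ->
  Pr (~` A) <= p%:E -> (1 - p)%:E <= Pr A.
Proof.
move=> mA; rewrite probability_setC // -(fineK (fin_num_measure Pr A mA)).
by rewrite -EFinB !lee_fin => h; lra.
Qed.

End union_bound.

(** A nonzero vector is what extracts the signs of [L] and [M] from the Lipschitz bounds. *)
Lemma exists_enorm_gt0 (R : realType) n : (0 < n)%N -> exists y : 'cV[R]_n, 0 < enorm y.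
Proof.
case: n => // n _; exists (const_mx 1); rewrite lt_def enorm_ge0 andbT.
apply/eqP => /enorm_eq0 /matrixP /(_ 0 0); rewrite !mxE => /eqP.
by rewrite oner_eq0.
Qed.

(** * The complexity and stationarity guarantee *)

Unset Implicit Arguments.

Theorem theorem3p1 (R : realType) :
  (* constant of the iteration bound, a function of M and f x0 - inf f *)
  exists Kiter : R -> R -> R,
  forall Cs C : R, sing_val_const Cs -> JL_const C ->
  (* lower bound on n / s expressing s << n; FOSP constant as a function of
     L, M, tau, c *)
  exists (rho : R) (K : R -> R -> R -> R -> R),
  Cs < Num.sqrt rho /\
  forall (L M tau c eps : R) (s n : nat) (f : 'cV[R]_n -> R) (x0 : 'cV[R]_n)
    (d : measure_display) (T : measurableType d) (Pr : probability T R)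
    (P : nat -> 'I_s -> 'I_n -> {RV Pr >-> R})
    (v : nat -> 'I_s -> {RV Pr >-> R}) (t : nat -> {RV Pr >-> R}),
  let delta := (Num.sqrt (n%:R / s%:R) + Cs) ^+ 2 * Num.sqrt eps in
  let Delta := Num.sqrt eps / M in
  let gap := f x0 - inf (range f) in
  let U : R := (Num.floor (3 * M ^+ 2 * gap * eps `^ (- (3 / 2))))%:~R + 1 in
  (0 < s)%N -> rho <= n%:R / s%:R ->
  C2 f -> has_lbound (range f) ->
  (forall x y, enorm (grad f x - grad f y) <= L * enorm (x - y)) ->
  (forall x y, opnorm (hess f x - hess f y) <= M * enorm (x - y)) ->
  0 < eps -> eps <= M ^+ 2 / 8 ->
  0 < tau -> 0 < c -> s%:R <= c * n%:R * eps `^ tau^-1 ->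
  rshtr_run x0 Delta P v t f delta ->
  ((1 - 4 * expR (- (C * s%:R / 4)) - (2 * U + 2) * expR (- s%:R))%:E <=
   Pr [set w | exists k : nat,
         [/\ (k.+1%:R <= Kiter M gap * eps `^ (- (3 / 2)))%R,
             terminates_at Delta P v t k w
           & (enorm (grad f (iterate x0 Delta P v t k w))
                <= K L M tau c * (n%:R / s%:R) `^ ((2 + tau) / 2) * eps)%R]])%E.
Proof.
(* The second summand pays for the [+ 1] in [U]: since [eps <= M^2 / 8], it is at least 1 after
   multiplication by [eps^(-3/2)]. *)
exists (fun M gap => 3 * M ^+ 2 * gap + (M ^+ 2 / 8) `^ (3 / 2)) => Cs C Cs_sv _.
(* This [rho] makes [sqrt (n / s) - Cs] at least 1 and at least half of [sqrt (n / s)]. In [K],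
   [expR (5 / 2)] inverts the small-ball radius, and the last factor comes from [sqrt_le_powR]. *)
exists ((2 * `|Cs| + 2) ^+ 2),
  (fun L M tau c => expR (5 / 2) * (2 * L / M + 6) * c `^ (tau / 2)).
have absCs := ler_norm Cs; have absCs' := ler_norm (- Cs); rewrite normrN in absCs'.
have absCs0 := normr_ge0 Cs.
have rho0 : 0 <= 2 * `|Cs| + 2 by lra.
split; first by rewrite sqrtr_sqr ger0_norm //; lra.
move=> L M tau c eps s n f x0 d T Pr P v t delta Delta gap U s_gt0 rho_le f_C2 f_lb
  gradL hessM eps0 eps_le tau0 c0 s_le run.
have s0 : 0 < s%:R :> R by rewrite ltr0n.
pose q : R := n%:R / s%:R; rewrite -/q in rho_le *.
pose r := Num.sqrt q.
have r_ge : 2 * `|Cs| + 2 <= r.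
  by rewrite -[leLHS]ger0_norm // -sqrtr_sqr ler_wsqrtr.
have q0 : 0 < q by apply: lt_le_trans rho_le; rewrite exprn_gt0 //; lra.
have r2 : r ^+ 2 = q by rewrite sqr_sqrtr // ltW.
have sn : (s <= n)%N.
  rewrite -(ler_nat R) -[leLHS]mul1r -ler_pdivlMr //.
  by apply: le_trans rho_le; rewrite -(expr1n _ 2) ler_pXn2r ?nnegrE //; lra.
have n_gt0 : (0 < n)%N by exact: leq_trans sn.
have [y0 y0_gt0] := @exists_enorm_gt0 R n n_gt0.
have L0 : 0 <= L.
  have := le_trans (enorm_ge0 _) (gradL y0 0).
  by rewrite subr0 pmulr_lge0.
have M_ge0 : 0 <= M.
  have := hessM y0 0; rewrite subr0 => h; rewrite -(pmulr_lge0 _ y0_gt0).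
  apply: le_trans h; rewrite -(pmulr_lge0 _ y0_gt0).
  exact: le_trans (enorm_ge0 _) (enorm_le_opnorm _ y0).
have M_gt0 : 0 < M.
  rewrite lt_def M_ge0 andbT; apply/eqP => M0; move: eps_le.
  by rewrite M0 expr0n /= mul0r leNgt eps0.
pose e := Num.sqrt eps.
have e0 : 0 < e by rewrite sqrtr_gt0.
have e2 : e ^+ 2 = eps by rewrite sqr_sqrtr // ltW.
have Delta_gt0 : 0 < Delta by exact: divr_gt0.
have Delta2 : Delta ^+ 2 <= 8^-1.
  rewrite /Delta expr_div_n e2 ler_pdivrMr ?exprn_gt0 //.
  by rewrite mulrC.
have Delta_lt1 : Delta < 1 by rewrite -(@expr_lt1 _ 2) ?(ltW Delta_gt0) //; lra.
have sigma_gt0 : 0 < r + Cs by lra.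
have sigma1_ge1 : 1 <= r - Cs by lra.
have r_gt1 : 1 < r by lra.
have r_gt0 : 0 < r by lra.
pose g k w := grad f (iterate x0 Delta P v t k w).
pose a : R := expR (- (5 / 2)).
pose SV k := [set w | forall y : 'cV[R]_s,
  (r - Cs) * enorm y <= enorm ((rv_mx (P k) w)^T *m y) <= (r + Cs) * enorm y].
pose B k := [set w | enorm (rv_mx (P k) w *m g k w) < a * enorm (g k w)].
have mP k i j : measurable_fun setT (fun w => rv_mx (P k) w i j).
  by under eq_fun do rewrite mxE; exact: measurable_funP.
have mSV k : measurable (SV k).
  by apply: measurable_sing_val => i j; under eq_fun do rewrite mxE; exact: mP.
have PrSV k : (Pr (~` SV k) <= (2 * expR (- s%:R))%:E)%E.
  apply: prob_setC_le => //; apply: Cs_sv => //; first by rewrite s_gt0.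
  exact: run_gaussian run k.
have cgrad i : continuous (fun y : 'cV[R]_n => grad f y i 0).
  move=> y; apply: differentiable_continuous; apply: differentiable_entry.
  by have [_ + _] := f_C2; exact.
have mg_past k i := measurable_continuous_comp (cgrad i)
  (fun j => @measurable_iterate _ _ _ _ _ _ x0 Delta P v t k k j (leqnn k)).
have mg k i : measurable_fun setT (fun w => g k w i 0).
  exact: measurableT_comp (mg_past k i)
    (measurable_id_g_sigma (@past_generator_measurable _ _ _ _ _ _ P v t k)).
have mB k : measurable (B k).
  apply: measurable_set_lt; last by apply: measurable_funM => //; exact: measurable_enorm.
  by apply: measurable_enorm => i; exact: measurable_mulmx.
have PrB k : (Pr (B k) <= (expR (- (2 * s%:R)))%:E)%E.
  have indep_k : indep_events Pr <<s past_generator P v t k >>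
      <<s \bigcup_i \bigcup_l rv_events (P k i l) >>.
    by move=> A A' pA dA; exact: (run_indep run (k := k)).
  apply: (gaussian_small_ball_indep (run_gaussian run k) s_gt0 _ _ indep_k).
  - exact: past_generator_measurable.
  - by move=> A [i _ [l _]]; exact: rv_events_measurable.
  - by move=> i j A PA; exists i => //; exists j.
  - exact: mg_past.
(* The bad event of index [k]. The draw is independent of the past at every index, so nothing is
   conditioned on iteration [k] being reached, and the random termination index is covered by the
   union over [k < N]. *)
pose A k := ~` SV k `|` B k.
set p : R := 2 * expR (- s%:R) + expR (- (2 * s%:R)).
have mA k : measurable (A k) by apply: measurableU => //; exact: measurableC.
have PrA k : (Pr (A k) <= p%:E)%E.
  apply: (le_trans (measureU2 Pr (measurableC (mSV k)) (mB k))).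
  by rewrite /p EFinD; apply: leeD; [exact: PrSV|exact: PrB].
set E := [set w | exists k : nat, _].
have mE : measurable E.
  pose iter_ok k : bool := k.+1%:R <=
    (3 * M ^+ 2 * gap + (M ^+ 2 / 8) `^ (3 / 2)) * eps `^ (- (3 / 2)).
  pose tol := expR (5 / 2) * (2 * L / M + 6) * c `^ (tau / 2) * q `^ ((2 + tau) / 2) * eps.
  rewrite (_ : E = \bigcup_k (if iter_ok k then
      [set w | terminates_at Delta P v t k w] `&` [set w | enorm (g k w) <= tol] else set0)).
    apply: bigcupT_measurable => k; case: ifP => // _; apply: measurableI.
      exact: measurable_terminates_at.
    by apply: measurable_set_le => //; exact: measurable_enorm.
  apply/seteqP; split=> w /=.
    by move=> [k [k_ok term g_le]]; exists k => //; rewrite /iter_ok k_ok.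
  by move=> [k _]; rewrite /iter_ok; case: ifP => // k_ok [term g_le]; exists k.
have [U_big|U_small] := leP 1 ((2 * U + 2) * expR (- s%:R)).
  apply: (le_trans _ (measure_ge0 Pr E)); rewrite lee_fin.
  by have := expR_ge0 (- (C * s%:R / 4)); lra.
have gap0 : 0 <= gap.
  by rewrite subr_ge0; apply: ge_inf => //; exists x0.
have powE : eps `^ (- (3 / 2)) = (e ^+ 3)^-1 by exact: powR_neg32.
have e3 : 0 < e ^+ 3 by exact: exprn_gt0.
pose z := 3 * M ^+ 2 * gap * eps `^ (- (3 / 2)).
have z0 : 0 <= z by rewrite !mulr_ge0 ?powR_ge0 ?sqr_ge0.
pose N := `|Num.floor z|%N.+1.
have UE : U = N%:R.
  have fz : Num.floor z = `|Num.floor z|%N :> int by rewrite gez0_abs // floor_ge0.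
  transitivity (`|Num.floor z|%N%:R + 1 : R); last by rewrite natr1.
  by rewrite /U -/z [in LHS]fz.
have z_lt : z < N%:R by rewrite -UE /U -[1]/(1%:~R) -intrD floorD1_gt.
have N_le : N%:R <= z + 1 by rewrite -UE lerD2r floor_le.
apply: (@le_trans _ _ (1 - p *+ N)%:E).
  rewrite lee_fin UE /p.
  (* Here [(2 N + 2) * exp(-s) < 1], so the small-ball term [N * exp(-2 s)] is at most [exp(-s) / 2]
     and fits into the [+ 2] of the budget. *)
  have -> : expR (- (2 * s%:R)) = expR (- s%:R) * expR (- s%:R) :> R.
    by rewrite -expRD; congr expR; ring.
  rewrite -[X in _ <= _ - X]mulr_natr; rewrite UE in U_small.
  move: U_small (expR_ge0 (- (C * s%:R / 4))) (expR_gt0 (- s%:R : R)).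
  move: (expR _) (expR _) (N%:R : R) => b E' m h1 h2 h3.
  have : (2 * m + 2) * E' * E' <= E' by rewrite ler_piMl // ltW.
  by have := sqr_ge0 E'; move: h2 h3; clear; lra.
apply: prob_setC_ge => //.
have ub := union_bound N mA PrA.
apply: le_trans ub; apply: le_measure; rewrite ?inE.
- exact: measurableC.
- by apply: bigcup_measurable => k _.
move=> w; apply: contra_notP => w_good.
have Sw k : (k < N)%N -> SV k w.
  by move=> kN; apply: contrapT => nS; apply: w_good; exists k => //; left.
have Bw k : (k < N)%N -> a * enorm (g k w) <= enorm (rv_mx (P k) w *m g k w).
  by move=> kN; rewrite leNgt; apply/negP => Bk; apply: w_good; exists k => //; right.
have [|k kN term] := @exists_termination _ _ _ _ _ _ f x0 M e (r + Cs) delta P v t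
  f_C2 hessM M_gt0 e0 sigma_gt0 erefl run N w f_lb (fun k y kN => (andP (Sw k kN y)).2).
  by rewrite -ltr_pdivrMr // -powE.
exists k; split => //.
  apply: (@le_trans _ _ N%:R); first by rewrite ler_nat.
  rewrite (le_trans N_le) // mulrDl lerD2l.
  have eps_ge0 := ltW eps0.
  have : eps `^ (3 / 2) <= (M ^+ 2 / 8) `^ (3 / 2).
    by apply: ge0_ler_powR => //; rewrite ?nnegrE ?divr_ge0 ?sqr_ge0.
  by rewrite powRN ler_pdivlMr ?powR_gt0 // mul1r.
have Pg_le := termination_grad_le f_C2 M_gt0 e0 sigma_gt0 erefl run sigma1_ge1
  Delta_lt1 L0 gradL (Sw k kN) term.
have {}Pg_le := sketched_grad_bound r_ge L0 M_gt0 e0 Delta2 (ltW Delta_lt1)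
  (enorm_ge0 _) Pg_le.
have g_le : enorm (g k w) <= expR (5 / 2) * (r * e * (2 * L / M + 6)).
  by rewrite -ler_pdivrMl ?expR_gt0 // -expRN (le_trans (Bw k kN)).
have e_le : e <= c `^ (tau / 2) * q `^ (tau / 2) * eps.
  apply: sqrt_le_powR => //.
  rewrite /q -(ler_pM2r s0) mul1r (le_trans s_le) // le_eqVlt; apply/orP; left.
  by apply/eqP; field; rewrite gt_eqF.
(* Weakening [sqrt (n / s)] to [n / s], which exceeds 1, brings the power of [n / s] to
   [1 + tau / 2]. *)
have r_le : r <= q by rewrite -r2 expr2 ler_peMl ?(ltW r_gt0) ?(ltW r_gt1).
have -> : (2 + tau) / 2 = 1 + tau / 2 by field.
rewrite powRD; last by rewrite (gt_eqF q0) implybT.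
rewrite powRr1 ?(ltW q0) //; apply: (le_trans g_le).
set K := 2 * L / M + 6; have K0 : 0 <= K by rewrite addr_ge0 // divr_ge0 // mulr_ge0.
have -> : expR (5 / 2) * K * c `^ (tau / 2) * (q * q `^ (tau / 2)) * eps =
    expR (5 / 2) * (q * (c `^ (tau / 2) * q `^ (tau / 2) * eps) * K) by ring.
rewrite ler_wpM2l ?expR_ge0 // ler_wpM2r //.
by rewrite ler_pM ?(ltW r_gt0) ?(ltW e0).
Qed.
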